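(* Let $\sigma>0$ and $d\ge 2$ be such that $s_c:=\frac d2-\frac1\sigma>0$. Then for any given initial value $Q_0\in\mathbb{R}$ and any constant $a>0$, there is a unique $C^2$ function $Q:[0,\infty)\to\mathbb{C}$ satisfying $$\Delta_\xi Q-Q+ia\left(\frac{Q}{\sigma}+\xi Q_\xi\right)+|Q|^{2\sigma}Q=0\quad(\xi>0),\qquad Q_\xi(0)=0,\quad Q(0)=Q_0,\quad \lim_{\xi\to\infty}Q(\xi)=0.$$
   Context: Here $\Delta_\xi:=\partial_{\xi\xi}+\frac{d-1}{\xi}\partial_\xi$ is the radial Laplacian in dimension $d$, where $d$ enters the equation only as a real parameter; $Q_\xi$ denotes the derivative of $Q$ in the radial variable $\xi\ge 0$, and $i$ is the imaginary unit. The value $Q(0)$ is real, while $Q$ is in general complex-valued. *)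

(* Defs.v *)
From Stdlib Require Import Reals.
From Coquelicot Require Import Coquelicot.
Open Scope R_scope.

Definition s_crit (d sigma : R) : R := d / 2 - 1 / sigma.

(** Real power [x ^ p] of [x >= 0] with exponent [p > 0]; the case split is
    there because [Rpower 0 p = 1]. *)
Definition rpow (x p : R) : R := if Rlt_dec 0 x then Rpower x p else 0.

(** A function on [[0, +oo)] is represented by [f : R -> C], and only its
    restriction to [half_line] is ever used: every limit below is taken along
    points of [half_line], so derivatives at [0] are one-sided. *)
Definition half_line (x : R) : Prop := 0 <= x.

Definition is_derive_on (D : R -> Prop) (f f1 : R -> C) : Prop :=
  forall x : R, D x ->
    @filterdiff R_AbsRing R_NormedModule C_R_NormedModule f
      (within D (locally x))
      (fun h : R => @scal R_AbsRing C_R_NormedModule h (f1 x)).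

Definition C2_on (D : R -> Prop) (f f1 f2 : R -> C) : Prop :=
  is_derive_on D f f1 /\ is_derive_on D f1 f2 /\
  @continuous_on R_UniformSpace C_UniformSpace D f2.

(** [Q1], [Q2] stand for the first two derivatives of the radial function. *)
Definition radial_laplacian (d : R) (Q1 Q2 : R -> C) (xi : R) : C :=
  (Q2 xi + RtoC ((d - 1) / xi) * Q1 xi)%C.

Definition profile_lhs (sigma d a : R) (Q Q1 Q2 : R -> C) (xi : R) : C :=
  (radial_laplacian d Q1 Q2 xi - Q xi
   + Ci * RtoC a * (Q xi / RtoC sigma + RtoC xi * Q1 xi)
   + RtoC (rpow (Cmod (Q xi)) (2 * sigma)) * Q xi)%C.

Definition is_profile (sigma d a Q0 : R) (Q : R -> C) : Prop :=
  exists Q1 Q2 : R -> C,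
    C2_on half_line Q Q1 Q2 /\
    (forall xi : R, 0 < xi -> profile_lhs sigma d a Q Q1 Q2 xi = RtoC 0) /\
    Q1 0 = RtoC 0 /\
    Q 0 = RtoC Q0 /\
    filterlim Q (Rbar_locally p_infty) (@locally C_UniformSpace (RtoC 0)).

(* Main.v *)
Require Import Defs.
From Stdlib Require Import Reals Lra Lia.
From Coquelicot Require Import Coquelicot.
Open Scope R_scope.

(** Write Q = u + i v, Q' = p + i q and N = |Q|^2.  The equation is a singular
    linear operator plus a nonlinearity h(N) Q with h(s) = s^sigma.

    Existence.  Cutting h off at a height K makes h(N) Q globally Lipschitz
    ([truncated_power_lipschitz]), and the initial value problem at the singular
    point 0, written as
      Q(x) = Q0 + int_0^x Q',   Q'(x) = x^(1-d) int_0^x s^(d-1) (forcing) ds,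
    then has a solution on the whole half line, because the right-hand side
    contracts a norm with a fast growing weight
    ([smooth_radial_solution_exists]).  It remains to bound N independently of K.

    On a bounded interval the energy |Q'|^2/2 + N/2 + H(N)/2, with H' = h, grows
    at most exponentially, since the term i a x Q' does no work
    ([energy_growth]).

    For large x, put w = Q' + i (a x/2) Q; up to a unimodular factor this is the
    derivative of exp(i a x^2/4) Q, a substitution that trades the drift for the
    repulsive potential a^2 x^2/4.  With T = |w|^2, V = a^2 x^2 N/4 and
    F = Re (Q' conj Q), the functional
      L = T/2 + V/2 - N/2 + H(N)/2 + (d/2) F/x
    satisfies x L' <= (1 - 1/sigma) (T + V) + lower order terms.  Here the
    multiple of F/x equalises the coefficients of T and V, and s_c = d/2 - 1/sigma
    enters, being nonnegative, through s_c a x Im (w conj Q) <= s_c (T + V).  The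
    lower order terms are O(x^-1) (T + V), so x L' <= k L for some k < 2
    ([lyapunov_decay]).  Since V <= 4 L, this gives N = O(x^(k-2))
    ([modulus_decay]).  This is the limit 0 at infinity and, together with the
    energy bound on the initial interval, a bound for N that depends on sigma, d,
    a and Q0 alone.  If K exceeds it, the truncation is never felt, and the
    solution solves the original equation.

    Uniqueness.  The squared difference of two solutions, with their first
    derivatives, vanishes at 0 and satisfies a Gronwall inequality on each bounded
    interval: the singular friction term has the good sign, and again the drift
    does no work ([radial_solution_unique]). *)

(** * Continuity, derivatives and monotonicity *)

Lemma continuous_epsilon (f : R -> R) (x : R) :
  continuous f x <->
  (forall eps, 0 < eps -> exists delta, 0 < delta /\
     forall y, Rabs (y - x) < delta -> Rabs (f y - f x) < eps).
Proof.
  split.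
  - intros H eps He.
    destruct (proj1 (filterlim_locally f (f x)) H (mkposreal eps He))
      as [delta Hd].
    exists delta; split; [apply cond_pos|].
    intros y Hy; exact (Hd y Hy).
  - intros H; apply filterlim_locally; intros eps.
    destruct (H eps (cond_pos eps)) as [delta [Hd Hf]].
    exists (mkposreal delta Hd); intros y Hy; exact (Hf y Hy).
Qed.

Lemma continuous_near (f g : R -> R) (x delta : R) :
  0 < delta -> (forall y, Rabs (y - x) < delta -> f y = g y) ->
  continuous f x -> continuous g x.
Proof.
  intros Hd Heq Hf.
  apply (continuous_ext_loc g f); [|exact Hf].
  exists (mkposreal delta Hd); intros y Hy; exact (Heq y Hy).
Qed.

Lemma is_derive_near (f g : R -> R) (x l delta : R) :
  0 < delta -> (forall y, Rabs (y - x) < delta -> f y = g y) ->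
  is_derive f x l -> is_derive g x l.
Proof.
  intros Hd Heq Hf.
  apply (is_derive_ext_loc f g); [|exact Hf].
  exists (mkposreal delta Hd); intros y Hy; exact (Heq y Hy).
Qed.

Lemma is_derive_continuous (f : R -> R) (x l : R) :
  is_derive f x l -> continuous f x.
Proof.
  intros H; apply (ex_derive_continuous f x); exists l; exact H.
Qed.

Lemma continuous_Rmax_0 (x : R) : continuous (Rmax 0) x.
Proof.
  apply continuous_epsilon; intros eps He; exists eps; split; [exact He|].
  intros y Hy; revert Hy; unfold Rmax, Rabs.
  destruct (Rle_dec 0 y), (Rle_dec 0 x); repeat destruct Rcase_abs; lra.
Qed.

(** The derivative is only required inside the interval, because the equation
    is singular at its left end point 0. *)
Lemma nonincreasing_of_derive (f df : R -> R) (a b : R) :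
  a <= b ->
  (forall x, a <= x <= b -> continuous f x) ->
  (forall x, a < x < b -> is_derive f x (df x)) ->
  (forall x, a < x < b -> df x <= 0) ->
  f b <= f a.
Proof.
  intros Hab Hc Hd Hneg.
  (* The mean value point may be an end point, where [df] is unconstrained. *)
  set (dg := fun x => if Rlt_dec a x then if Rlt_dec x b then df x else 0 else 0).
  destruct (MVT_gen f a b dg) as [c [_ Heq]].
  - rewrite Rmin_left, Rmax_right by exact Hab.
    intros x Hx; unfold dg.
    destruct (Rlt_dec a x); [|lra]; destruct (Rlt_dec x b); [|lra]; auto.
  - rewrite Rmin_left, Rmax_right by exact Hab.
    intros x Hx; apply continuity_pt_filterlim; exact (Hc x Hx).
  - assert (dg c <= 0).
    { unfold dg; destruct (Rlt_dec a c); [|lra]; destruct (Rlt_dec c b); [|lra].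
      apply Hneg; lra. }
    nra.
Qed.

Lemma gronwall (e de : R -> R) (C X : R) :
  0 <= X ->
  (forall x, 0 <= x -> continuous e x) ->
  (forall x, 0 < x < X -> is_derive e x (de x)) ->
  (forall x, 0 < x < X -> de x <= C * e x) ->
  e X <= e 0 * exp (C * X).
Proof.
  intros HX Hc Hd Hle.
  assert (H : e X * exp (- C * X) <= e 0 * exp (- C * 0)).
  { apply (nonincreasing_of_derive (fun x => e x * exp (- C * x))
             (fun x => (de x - C * e x) * exp (- C * x)) 0 X); auto.
    - intros x Hx.
      apply (continuous_mult e (fun x => exp (- C * x))).
      + apply Hc; lra.
      + apply (ex_derive_continuous (fun x => exp (- C * x))).
        auto_derive; exact I.
    - intros x Hx; specialize (Hd x Hx); auto_derive.
      + eexists; exact Hd.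
      + replace (Derive _ x) with (de x) by (symmetry; apply is_derive_unique, Hd).
        ring.
    - intros x Hx; specialize (Hle x Hx).
      generalize (exp_pos (- C * x)); nra. }
  rewrite Rmult_0_r, exp_0, Rmult_1_r in H.
  apply (Rmult_le_compat_r (exp (C * X))) in H; [|left; apply exp_pos].
  rewrite Rmult_assoc, <- exp_plus in H.
  replace (- C * X + C * X) with 0 in H by ring.
  rewrite exp_0 in H; lra.
Qed.

Lemma continuous_Rplus (f g : R -> R) (x : R) :
  continuous f x -> continuous g x -> continuous (fun y => f y + g y) x.
Proof. exact (continuous_plus f g x). Qed.

Lemma continuous_Rminus (f g : R -> R) (x : R) :
  continuous f x -> continuous g x -> continuous (fun y => f y - g y) x.
Proof. exact (continuous_minus f g x). Qed.

Lemma continuous_Rmult (f g : R -> R) (x : R) :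
  continuous f x -> continuous g x -> continuous (fun y => f y * g y) x.
Proof. exact (continuous_mult f g x). Qed.

Lemma continuous_Rcomp (f g : R -> R) (x : R) :
  continuous f x -> continuous g (f x) -> continuous (fun y => g (f y)) x.
Proof. exact (continuous_comp f g x). Qed.

(** The patterns are matched syntactically: unification would unfold a
    subtraction into a sum and miss the intended lemma. *)
Ltac prove_continuous :=
  repeat match goal with
    | |- continuous (fun y => @?f y + @?g y) _ => apply (continuous_Rplus f g)
    | |- continuous (fun y => @?f y - @?g y) _ => apply (continuous_Rminus f g)
    | |- continuous (fun y => @?f y * @?g y) _ => apply (continuous_Rmult f g)
    | |- continuous (fun y => @?f y / ?c) _ => apply (continuous_Rmult f (fun _ => / c))
    | |- _ => assumption
    | |- _ => apply continuous_const
    | |- _ => apply continuous_id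
    end.

(** Replaces the [Derive] terms left by [auto_derive] with the derivatives
    recorded in the context. *)
Ltac fold_derivatives :=
  repeat match goal with
    | H : is_derive ?f ?x ?l |- context [Derive ?g ?x] =>
        replace (Derive g x) with l by (symmetry; apply is_derive_unique; exact H)
    end.

(** * Real powers *)

Lemma rpow_pos_eq (x p : R) : 0 < x -> rpow x p = Rpower x p.
Proof. intros H; unfold rpow; destruct (Rlt_dec 0 x); [reflexivity|lra]. Qed.

Lemma rpow_nonpos_eq (x p : R) : x <= 0 -> rpow x p = 0.
Proof. intros H; unfold rpow; destruct (Rlt_dec 0 x); [lra|reflexivity]. Qed.

Lemma rpow_nonneg (x p : R) : 0 <= rpow x p.
Proof.
  unfold rpow; destruct (Rlt_dec 0 x); [left; apply exp_pos|lra].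
Qed.

Lemma rpow_le (x y p : R) : 0 <= p -> x <= y -> rpow x p <= rpow y p.
Proof.
  intros Hp Hxy.
  destruct (Rlt_dec 0 x) as [Hx|Hx].
  - rewrite !rpow_pos_eq by lra. apply Rle_Rpower_l; lra.
  - rewrite (rpow_nonpos_eq x) by lra. apply rpow_nonneg.
Qed.

Lemma rpow_sqr (r p : R) : 0 <= r -> rpow (r * r) p = rpow r (2 * p).
Proof.
  intros [Hr|<-].
  - rewrite !rpow_pos_eq by nra.
    replace (2 * p) with (p + p) by ring.
    rewrite Rpower_plus, Rpower_mult_distr by assumption. reflexivity.
  - rewrite !rpow_nonpos_eq by lra; reflexivity.
Qed.

Lemma is_derive_Rpower (p x : R) :
  0 < x -> is_derive (fun y => Rpower y p) x (p * Rpower x p / x).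
Proof.
  intros Hx; unfold Rpower; auto_derive; [exact Hx|field; lra].
Qed.

Lemma rpow_continuous (p x : R) : 0 < p -> continuous (fun y => rpow y p) x.
Proof.
  intros Hp; destruct (Rtotal_order x 0) as [Hx|[->|Hx]].
  - apply (continuous_near (fun _ => 0) _ x (- x)); [lra| |apply continuous_const].
    intros y Hy; rewrite rpow_nonpos_eq; [reflexivity|].
    apply Rabs_def2 in Hy; lra.
  - apply continuous_epsilon; intros eps He.
    exists (Rpower eps (/ p)); split; [apply exp_pos|].
    intros y Hy; rewrite (rpow_nonpos_eq 0), !Rminus_0_r in * by lra.
    rewrite Rabs_pos_eq by apply rpow_nonneg.
    destruct (Rlt_dec 0 y) as [H0|H0]; [|rewrite rpow_nonpos_eq; lra].
    rewrite Rabs_pos_eq in Hy by lra.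
    rewrite rpow_pos_eq by exact H0.
    apply Rlt_le_trans with (Rpower (Rpower eps (/ p)) p).
    + apply Rlt_Rpower_l; lra.
    + rewrite Rpower_mult, Rinv_l, Rpower_1; lra.
  - apply (continuous_near (fun y => Rpower y p) _ x x); [lra| |].
    + intros y Hy; rewrite rpow_pos_eq; [reflexivity|].
      apply Rabs_def2 in Hy; lra.
    + eapply is_derive_continuous, is_derive_Rpower, Hx.
Qed.

(** * The average with weight s^(d-1) *)

(** For x > 0 this is x^(-d) int_0^x s^(d-1) phi(s) ds, the mean of phi up to the
    factor 1/d; the value at x <= 0 makes it continuous.  The solution of
    P' + (d-1)/x P = phi that is regular at 0 is x times this average. *)
Definition weighted_average (d : R) (phi : R -> R) (x : R) : R :=
  if Rlt_dec 0 x
  then RInt (fun s => rpow s (d - 1) * phi s) 0 x / rpow x d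
  else phi 0 / d.

Lemma ex_RInt_of_continuous (f : R -> R) (a b : R) :
  (forall x, continuous f x) -> ex_RInt f a b.
Proof.
  intros H; apply (ex_RInt_continuous (V := R_CompleteNormedModule)).
  intros z _; apply H.
Qed.

Lemma is_derive_primitive (f : R -> R) (x : R) :
  (forall y, continuous f y) -> is_derive (fun y => RInt f 0 y) x (f x).
Proof.
  intros H; apply (is_derive_RInt f (fun y => RInt f 0 y) 0 x); [|apply H].
  apply filter_forall; intros y.
  apply (RInt_correct (V := R_CompleteNormedModule)), ex_RInt_of_continuous, H.
Qed.

Lemma RInt_scal_continuous (f : R -> R) (a b c : R) :
  (forall x, continuous f x) -> RInt (fun s => c * f s) a b = c * RInt f a b.
Proof.
  intros H; apply (RInt_scal (V := R_CompleteNormedModule) f a b c).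
  apply ex_RInt_of_continuous, H.
Qed.

Lemma RInt_minus_continuous (f g : R -> R) (a b : R) :
  (forall x, continuous f x) -> (forall x, continuous g x) ->
  RInt (fun s => f s - g s) a b = RInt f a b - RInt g a b.
Proof.
  intros Hf Hg; apply (RInt_minus (V := R_CompleteNormedModule) f g a b);
    apply ex_RInt_of_continuous; assumption.
Qed.

Section Average.
Variable d : R.
Hypothesis Hd : 2 <= d.

Lemma continuous_weight (phi : R -> R) (x : R) :
  continuous phi x -> continuous (fun s => rpow s (d - 1) * phi s) x.
Proof.
  intros H; apply (continuous_mult (fun s => rpow s (d - 1)) phi); [|exact H].
  apply rpow_continuous; lra.
Qed.

Lemma is_derive_rpow_weight (x : R) :
  0 < x -> is_derive (fun y => rpow y d) x (d * rpow x (d - 1)).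
Proof.
  intros Hx.
  apply (is_derive_near (fun y => Rpower y d) _ x _ x Hx).
  - intros y Hy; rewrite rpow_pos_eq; [reflexivity|]; apply Rabs_def2 in Hy; lra.
  - replace (d * rpow x (d - 1)) with (d * Rpower x d / x).
    + apply is_derive_Rpower, Hx.
    + rewrite rpow_pos_eq by exact Hx.
      unfold Rminus; rewrite Rpower_plus, Rpower_Ropp, Rpower_1 by exact Hx.
      field; lra.
Qed.

Lemma rpow_weight_split (x : R) : 0 < x -> rpow x d = x * rpow x (d - 1).
Proof.
  intros Hx; rewrite !rpow_pos_eq by exact Hx.
  rewrite <- (Rpower_1 x Hx) at 2; rewrite <- Rpower_plus; f_equal; ring.
Qed.

Lemma RInt_weight (x : R) : 0 <= x -> RInt (fun s => rpow s (d - 1)) 0 x = rpow x d / d.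
Proof.
  intros [Hx|<-].
  2: { rewrite RInt_point, rpow_nonpos_eq by lra. unfold zero; simpl; field; lra. }
  assert (Hcw : forall s, continuous (fun s => rpow s (d - 1)) s)
    by (intros s; apply rpow_continuous; lra).
  set (f := fun x => RInt (fun s => rpow s (d - 1)) 0 x - rpow x d / d).
  assert (Hcf : forall y, continuous f y).
  { intros y; apply (continuous_minus (fun x => RInt (fun s => rpow s (d - 1)) 0 x)
      (fun x => rpow x d / d)).
    - eapply is_derive_continuous, is_derive_primitive, Hcw.
    - apply (continuous_mult (fun x => rpow x d) (fun _ => / d)).
      + apply rpow_continuous; lra.
      + apply continuous_const. }
  assert (Hdf : forall y, 0 < y -> is_derive f y 0).
  { intros y Hy; unfold f; evar_last.
    - apply (is_derive_minus (fun x => RInt (fun s => rpow s (d - 1)) 0 x)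
        (fun x => rpow x d / d)).
      + apply (is_derive_primitive (fun s => rpow s (d - 1))), Hcw.
      + apply (is_derive_scal_l (fun y => rpow y d) y (d * rpow y (d - 1)) (/ d)).
        apply is_derive_rpow_weight, Hy.
    - unfold minus, plus, opp, scal; simpl; unfold mult; simpl; field; lra. }
  assert (H1 : f x <= f 0).
  { apply (nonincreasing_of_derive f (fun _ => 0)); intros; try lra; auto.
    apply Hdf; lra. }
  assert (H2 : - f x <= - f 0).
  { apply (nonincreasing_of_derive (fun x => - f x) (fun _ => - 0)); intros; try lra.
    - apply (continuous_opp f); auto.
    - apply (is_derive_opp f). apply Hdf; lra. }
  assert (f 0 = 0).
  { unfold f; rewrite RInt_point, rpow_nonpos_eq by lra.
    unfold zero; simpl; field; lra. }
  assert (f x = 0) by lra.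
  unfold f in *; lra.
Qed.

(** The weight (s/x)^(d-1) is at most 1 on [0, x], so the singular integral
    operator is dominated by plain integration; this is what lets the Picard
    iteration ignore the singularity. *)
Lemma weighted_average_diff_le (phi psi k : R -> R) (x : R) :
  (forall y, continuous phi y) -> (forall y, continuous psi y) ->
  (forall y, continuous k y) ->
  0 <= x -> (forall s, 0 <= s <= x -> Rabs (phi s - psi s) <= k s) ->
  Rabs (x * weighted_average d phi x - x * weighted_average d psi x)
    <= RInt k 0 x.
Proof.
  intros Hphi Hpsi Hk [Hx|<-] Hle.
  2: { rewrite RInt_point, !Rmult_0_l, Rminus_0_r, Rabs_R0; apply Rle_refl. }
  unfold weighted_average; destruct (Rlt_dec 0 x) as [_|]; [|lra].
  assert (Hw : 0 < rpow x (d - 1)) by (rewrite rpow_pos_eq by exact Hx; apply exp_pos).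
  rewrite rpow_weight_split by exact Hx.
  assert (Hi : forall f : R -> R, (forall y, continuous f y) ->
            ex_RInt (fun s => rpow s (d - 1) * f s) 0 x).
  { intros f Hf; apply ex_RInt_of_continuous; intros; apply continuous_weight, Hf. }
  assert (Hc : forall y, continuous (fun s => phi s - psi s) y)
    by (intros y; apply (continuous_minus phi psi); auto).
  replace (_ - _) with (RInt (fun s => rpow s (d - 1) * (phi s - psi s)) 0 x
                        / rpow x (d - 1)).
  2: { replace (RInt _ 0 x) with (RInt (fun s => rpow s (d - 1) * phi s) 0 x
                        - RInt (fun s => rpow s (d - 1) * psi s) 0 x).
       - field; lra.
       - rewrite <- RInt_minus_continuous by (intros; apply continuous_weight; auto).
         apply (RInt_ext (V := R_CompleteNormedModule)); intros s _; simpl; ring. }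
  unfold Rdiv; rewrite Rabs_mult, (Rabs_pos_eq (/ _)) by (left; apply Rinv_0_lt_compat, Hw).
  apply Rmult_le_reg_r with (1 := Hw).
  rewrite Rmult_assoc, Rinv_l, Rmult_1_r by lra.
  apply Rle_trans with (RInt (fun s => rpow x (d - 1) * k s) 0 x).
  - apply Rle_trans with (RInt (fun s => Rabs (rpow s (d - 1) * (phi s - psi s))) 0 x).
    + apply abs_RInt_le; [lra|apply Hi, Hc].
    + apply RInt_le; [lra| | |].
      * apply ex_RInt_of_continuous; intros y.
        apply (continuous_Rabs_comp (fun s => rpow s (d - 1) * (phi s - psi s))).
        apply continuous_weight, Hc.
      * apply ex_RInt_of_continuous; intros y.
        apply (continuous_mult (fun _ => rpow x (d - 1)) k); [apply continuous_const|auto].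
      * intros s Hs; rewrite Rabs_mult, (Rabs_pos_eq (rpow _ _)) by apply rpow_nonneg.
        apply Rmult_le_compat.
        -- apply rpow_nonneg.
        -- apply Rabs_pos.
        -- apply rpow_le; lra.
        -- apply Hle; lra.
  - right; rewrite Rmult_comm.
    rewrite RInt_scal_continuous by exact Hk; reflexivity.
Qed.

(** The total mass of the weight x^(-d) s^(d-1) on [0, x] is 1/d, so the average
    moves by at most 1/d times the oscillation of phi. *)
Lemma weighted_average_close (phi : R -> R) (x eps : R) :
  (forall y, continuous phi y) -> 0 < x ->
  (forall s, 0 <= s <= x -> Rabs (phi s - phi 0) <= eps) ->
  Rabs (weighted_average d phi x - phi 0 / d) <= eps / d.
Proof.
  intros Hphi Hx Hle.
  unfold weighted_average; destruct (Rlt_dec 0 x) as [_|]; [|lra].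
  assert (Hw : 0 < rpow x d) by (rewrite rpow_pos_eq by exact Hx; apply exp_pos).
  assert (Hcw : forall s, continuous (fun s => rpow s (d - 1)) s)
    by (intros s; apply rpow_continuous; lra).
  assert (Hlin : forall c, RInt (fun s => c * rpow s (d - 1)) 0 x = c * (rpow x d / d)).
  { intros c; rewrite (RInt_scal_continuous (fun s => rpow s (d - 1))) by exact Hcw.
    rewrite RInt_weight by lra; reflexivity. }
  assert (Hbd : forall c s, continuous (fun s => c * rpow s (d - 1)) s).
  { intros c s; apply (continuous_mult (fun _ => c)); [apply continuous_const|apply Hcw]. }
  assert (Hu : RInt (fun s => rpow s (d - 1) * phi s) 0 x <= (phi 0 + eps) * (rpow x d / d)).
  { rewrite <- Hlin; apply RInt_le; [lra| | |].
    - apply ex_RInt_of_continuous; intros y; apply continuous_weight, Hphi.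
    - apply ex_RInt_of_continuous, Hbd.
    - intros s Hs; assert (Hs' := Hle s ltac:(lra)).
      apply Rabs_le_between in Hs'. generalize (rpow_nonneg s (d - 1)); nra. }
  assert (Hl : (phi 0 - eps) * (rpow x d / d) <= RInt (fun s => rpow s (d - 1) * phi s) 0 x).
  { rewrite <- Hlin; apply RInt_le; [lra| | |].
    - apply ex_RInt_of_continuous, Hbd.
    - apply ex_RInt_of_continuous; intros y; apply continuous_weight, Hphi.
    - intros s Hs; assert (Hs' := Hle s ltac:(lra)).
      apply Rabs_le_between in Hs'. generalize (rpow_nonneg s (d - 1)); nra. }
  apply (Rmult_le_compat_r (/ rpow x d)) in Hu; [|left; apply Rinv_0_lt_compat, Hw].
  apply (Rmult_le_compat_r (/ rpow x d)) in Hl; [|left; apply Rinv_0_lt_compat, Hw].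
  replace ((phi 0 + eps) * (rpow x d / d) * / rpow x d)
    with (phi 0 / d + eps / d) in Hu by (field; lra).
  replace ((phi 0 - eps) * (rpow x d / d) * / rpow x d)
    with (phi 0 / d - eps / d) in Hl by (field; lra).
  apply Rabs_le_between; unfold Rdiv in *; lra.
Qed.

Lemma weighted_average_nonpos (phi : R -> R) (x : R) :
  x <= 0 -> weighted_average d phi x = phi 0 / d.
Proof. intros H; unfold weighted_average; destruct (Rlt_dec 0 x); [lra|reflexivity]. Qed.

Lemma weighted_average_is_derive_pos (phi : R -> R) (x : R) :
  (forall y, continuous phi y) -> 0 < x ->
  is_derive (weighted_average d phi) x
    (phi x / x - d * weighted_average d phi x / x).
Proof.
  intros Hphi Hx.
  apply (is_derive_near
    (fun x => RInt (fun s => rpow s (d - 1) * phi s) 0 x / rpow x d) _ x _ x Hx).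
  { intros y Hy; unfold weighted_average; destruct (Rlt_dec 0 y); [reflexivity|].
    apply Rabs_def2 in Hy; lra. }
  assert (Hw : 0 < rpow x (d - 1)) by (rewrite rpow_pos_eq by exact Hx; apply exp_pos).
  assert (Hs := rpow_weight_split x Hx).
  evar_last.
  - apply (is_derive_div (fun x => RInt (fun s => rpow s (d - 1) * phi s) 0 x)
             (fun x => rpow x d)).
    + apply (is_derive_primitive (fun s => rpow s (d - 1) * phi s)).
      intros y; apply continuous_weight, Hphi.
    + apply is_derive_rpow_weight, Hx.
    + rewrite Hs; nra.
  - unfold weighted_average; destruct (Rlt_dec 0 x) as [_|]; [|lra].
    rewrite Hs; field; lra.
Qed.

Lemma weighted_average_continuous (phi : R -> R) (x : R) :
  (forall y, continuous phi y) -> continuous (weighted_average d phi) x.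
Proof.
  intros Hphi; destruct (Rtotal_order x 0) as [Hx|[->|Hx]].
  - apply (continuous_near (fun _ => phi 0 / d) _ x (- x)); [lra| |apply continuous_const].
    intros y Hy; apply Rabs_def2 in Hy; rewrite weighted_average_nonpos by lra; reflexivity.
  - apply continuous_epsilon; intros eps He.
    destruct (proj1 (continuous_epsilon phi 0) (Hphi 0) eps He) as [delta [Hdl Hcl]].
    exists delta; split; [exact Hdl|]; intros y Hy.
    rewrite (weighted_average_nonpos phi 0) by lra.
    destruct (Rlt_dec 0 y) as [H0|H0].
    + apply Rle_lt_trans with (eps / d).
      * apply weighted_average_close; auto.
        intros s Hs; left; apply Hcl; rewrite Rminus_0_r in *.
        rewrite Rabs_pos_eq in * by lra; lra.
      * apply Rmult_lt_reg_r with d; [lra|].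
        unfold Rdiv; rewrite Rmult_assoc, Rinv_l by lra; nra.
    + rewrite weighted_average_nonpos by lra.
      rewrite Rminus_diag, Rabs_R0; exact He.
  - eapply is_derive_continuous, weighted_average_is_derive_pos; auto.
Qed.

(** At 0 the difference quotient of y |-> y A(y) is A itself, so continuity of
    the average A gives a two-sided derivative there, with the same formula as
    for x > 0. *)
Lemma scaled_average_is_derive (phi : R -> R) (x : R) :
  (forall y, continuous phi y) -> 0 <= x ->
  is_derive (fun y => y * weighted_average d phi y) x
    (phi x - (d - 1) * weighted_average d phi x).
Proof.
  intros Hphi [Hx|<-].
  - evar_last.
    + apply (is_derive_mult (fun y => y) (weighted_average d phi)).
      * apply is_derive_id.
      * apply weighted_average_is_derive_pos; auto.
      * intros; apply Rmult_comm.
    + unfold plus, mult, one; simpl; field; lra.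
  - apply is_derive_Reals; intros eps He.
    destruct (proj1 (continuous_epsilon (weighted_average d phi) 0)
                (weighted_average_continuous phi 0 Hphi) eps He) as [delta [Hdl Hcl]].
    exists (mkposreal delta Hdl); intros h Hh0 Hh; simpl in Hh.
    replace (_ - _) with (weighted_average d phi h - weighted_average d phi 0).
    + apply Hcl; rewrite Rminus_0_r; exact Hh.
    + rewrite (weighted_average_nonpos phi 0), Rplus_0_l by lra; field; split; lra.
Qed.

End Average.

(** * Picard iteration in a weighted norm *)

Lemma exists_geometric_small (A eps : R) :
  0 < eps -> exists n : nat, A * (/ 2) ^ n < eps.
Proof.
  intros He.
  assert (HA : 0 < Rabs A + 1) by (generalize (Rabs_pos A); lra).
  destruct (pow_lt_1_zero (/ 2) ltac:(rewrite Rabs_pos_eq; lra) (eps / (Rabs A + 1)))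
    as [n Hn].
  { apply Rdiv_lt_0_compat; assumption. }
  exists n; specialize (Hn n (le_n n)).
  assert (Hp : 0 < (/ 2) ^ n) by (apply pow_lt; lra).
  rewrite Rabs_pos_eq in Hn by lra.
  apply (Rmult_lt_compat_r (Rabs A + 1)) in Hn; [|exact HA].
  unfold Rdiv in Hn; rewrite Rmult_assoc, Rinv_l in Hn by lra.
  generalize (Rle_abs A); nra.
Qed.

Lemma eq_of_geometric_bound (x y A : R) :
  (forall n : nat, Rabs (x - y) <= A * (/ 2) ^ n) -> x = y.
Proof.
  intros H.
  destruct (Req_dec x y) as [E|E]; [exact E|exfalso].
  destruct (exists_geometric_small A (Rabs (x - y))) as [n Hn].
  - apply Rabs_pos_lt; lra.
  - specialize (H n); lra.
Qed.

(** Banach's fixed point theorem for the distance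
    sup_{i,x} |y i x - z i x| / W(x), started at [y0].  A family of functions
    indexed by [I] stands for a vector-valued function, and the iterates converge
    locally uniformly because W is locally bounded. *)
Lemma weighted_fixed_point (I : Type) (W : R -> R)
    (Phi : (I -> R -> R) -> I -> R -> R) (y0 : I -> R -> R) (c : R) :
  (forall x, continuous W x) -> (forall x, 0 <= W x) -> 0 <= c ->
  (forall i x, continuous (y0 i) x) ->
  (forall y, (forall i x, continuous (y i) x) -> forall i x, continuous (Phi y i) x) ->
  (forall y z b, (forall i x, continuous (y i) x) -> (forall i x, continuous (z i) x) ->
     0 <= b -> (forall i x, Rabs (y i x - z i x) <= b * W x) ->
     forall i x, Rabs (Phi y i x - Phi z i x) <= b / 2 * W x) ->
  (forall i x, Rabs (Phi y0 i x - y0 i x) <= c * W x) ->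
  exists y, (forall i x, continuous (y i) x) /\ (forall i x, Phi y i x = y i x).
Proof.
  intros HW HW0 Hc Hy0 Hcont Hcontr Hfirst.
  set (it := fun n => Nat.iter n Phi y0).
  assert (Hit : forall n i x, continuous (it n i) x).
  { induction n; simpl; [exact Hy0|apply Hcont, IHn]. }
  assert (Hpow : forall n, 0 < (/ 2) ^ n) by (intros; apply pow_lt; lra).
  assert (Hstep : forall n i x, Rabs (it (S n) i x - it n i x) <= c * (/ 2) ^ n * W x).
  { induction n; intros i x.
    - simpl; rewrite Rmult_1_r; apply Hfirst.
    - replace (c * (/ 2) ^ S n) with (c * (/ 2) ^ n / 2) by (simpl; field).
      apply (Hcontr (it (S n)) (it n)); auto.
      specialize (Hpow n); nra. }
  assert (Hdiff : forall n k i x,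
            Rabs (it (n + k)%nat i x - it n i x) <= 2 * c * (/ 2) ^ n * W x).
  { assert (Hdiff' : forall k n i x,
      Rabs (it (n + k)%nat i x - it n i x)
        <= (2 * c * (/ 2) ^ n - 2 * c * (/ 2) ^ (n + k)) * W x).
    { induction k; intros n i x.
      - rewrite Nat.add_0_r, Rminus_diag, Rabs_R0; lra.
      - replace (it (n + S k)%nat i x - it n i x)
          with ((it (S (n + k)) i x - it (n + k)%nat i x)
                + (it (n + k)%nat i x - it n i x))
          by (rewrite Nat.add_succ_r; ring).
        eapply Rle_trans; [apply Rabs_triang|].
        specialize (IHk n i x); specialize (Hstep (n + k)%nat i x).
        rewrite Nat.add_succ_r; simpl pow; lra. }
    intros n k i x; eapply Rle_trans; [apply Hdiff'|].
    apply Rmult_le_compat_r; [apply HW0|].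
    specialize (Hpow (n + k)%nat); nra. }
  assert (Hlim : forall i x, ex_finite_lim_seq (fun n => it n i x)).
  { intros i x; apply ex_lim_seq_cauchy_corr; intros eps.
    destruct (exists_geometric_small (2 * c * W x) (eps / 2)) as [N HN].
    { generalize (cond_pos eps); lra. }
    exists N; intros n m Hn Hm.
    replace n with (N + (n - N))%nat by lia.
    replace m with (N + (m - N))%nat by lia.
    assert (H1 := Hdiff N (n - N)%nat i x); assert (H2 := Hdiff N (m - N)%nat i x).
    replace (_ - _) with ((it (N + (n - N))%nat i x - it N i x)
      - (it (N + (m - N))%nat i x - it N i x)) by ring.
    eapply Rle_lt_trans; [apply Rabs_triang|]; rewrite Rabs_Ropp.
    replace (2 * c * W x * (/ 2) ^ N) with (2 * c * (/ 2) ^ N * W x) in HN by ring.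
    lra. }
  set (y := fun i x => real (Lim_seq (fun n => it n i x))).
  assert (Hy : forall i x, is_lim_seq (fun n => it n i x) (y i x)).
  { intros i x; apply Lim_seq_correct', Hlim. }
  assert (Hrate : forall n i x, Rabs (y i x - it n i x) <= 2 * c * (/ 2) ^ n * W x).
  { intros n i x.
    assert (H := is_lim_seq_abs _ _ (is_lim_seq_minus' _ _ _ _
      (proj1 (is_lim_seq_incr_n _ n _) (Hy i x)) (is_lim_seq_const (it n i x)))).
    refine (is_lim_seq_le _ (fun _ => 2 * c * (/ 2) ^ n * W x) _ _ _ H (is_lim_seq_const _)).
    intros k; simpl; rewrite Nat.add_comm; apply Hdiff. }
  assert (Hyc : forall i x, continuous (y i) x).
  { intros i x; apply continuous_epsilon; intros eps He.
    destruct (exists_geometric_small (2 * c * (W x + 1)) (eps / 3)) as [n Hn]; [lra|].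
    destruct (proj1 (continuous_epsilon _ _) (HW x) 1 Rlt_0_1) as [d1 [Hd1 H1]].
    destruct (proj1 (continuous_epsilon _ _) (Hit n i x) (eps / 3)) as [d2 [Hd2 H2]];
      [lra|].
    exists (Rmin d1 d2); split; [apply Rmin_pos; assumption|]; intros z Hz.
    assert (Hz1 := H1 z (Rlt_le_trans _ _ _ Hz (Rmin_l _ _))).
    assert (Hz2 := H2 z (Rlt_le_trans _ _ _ Hz (Rmin_r _ _))).
    apply Rabs_def2 in Hz1.
    assert (Hx := Hrate n i x); assert (Hz' := Hrate n i z).
    assert (Hk : 0 <= 2 * c * (/ 2) ^ n) by (specialize (Hpow n); nra).
    assert (2 * c * (/ 2) ^ n * W x < eps / 3) by nra.
    assert (2 * c * (/ 2) ^ n * W z < eps / 3) by nra.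
    replace (y i z - y i x)
      with ((y i z - it n i z) + ((it n i z - it n i x) - (y i x - it n i x))) by ring.
    eapply Rle_lt_trans; [apply Rabs_triang|].
    eapply Rle_lt_trans; [apply Rplus_le_compat_l, Rabs_triang|].
    rewrite Rabs_Ropp; lra. }
  exists y; split; [exact Hyc|]; intros i x.
  apply (eq_of_geometric_bound _ _ (2 * c * W x)); intros n.
  replace (Phi y i x - y i x)
    with ((Phi y i x - Phi (it n) i x) - (y i x - it (S n) i x)) by (simpl; ring).
  eapply Rle_trans; [apply Rabs_triang|]; rewrite Rabs_Ropp.
  assert (H1 : Rabs (Phi y i x - Phi (it n) i x) <= 2 * c * (/ 2) ^ n / 2 * W x).
  { apply Hcontr; auto. specialize (Hpow n); nra. }
  assert (H2 := Hrate (S n) i x); simpl pow in H2.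
  nra.
Qed.

(** * The radial equation in real coordinates *)

(** Real and imaginary parts of Q - i a (Q/sigma + x Q') - h(N) Q, so that the
    equation reads Q'' + (d-1)/x Q' = forcing. *)
Definition force_re (h : R -> R) (sigma a x u v q : R) : R :=
  u + a * (v / sigma + x * q) - h (u * u + v * v) * u.

Definition force_im (h : R -> R) (sigma a x u v p : R) : R :=
  v - a * (u / sigma + x * p) - h (u * u + v * v) * v.

(** All derivatives are two-sided, at 0 as well, so that restricting to the half
    line yields the one-sided C^2 regularity of a profile. *)
Record smooth_radial_solution (h : R -> R) (sigma d a Q0 : R)
    (u v p q p' q' : R -> R) : Prop := {
  srs_u : forall x, 0 <= x -> is_derive u x (p x);
  srs_v : forall x, 0 <= x -> is_derive v x (q x);
  srs_p : forall x, 0 <= x -> is_derive p x (p' x);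
  srs_q : forall x, 0 <= x -> is_derive q x (q' x);
  srs_p' : forall x, 0 <= x -> continuous p' x;
  srs_q' : forall x, 0 <= x -> continuous q' x;
  srs_re : forall x, 0 < x ->
    p' x = force_re h sigma a x (u x) (v x) (q x) - (d - 1) / x * p x;
  srs_im : forall x, 0 < x ->
    q' x = force_im h sigma a x (u x) (v x) (p x) - (d - 1) / x * q x;
  srs_u0 : u 0 = Q0;
  srs_v0 : v 0 = 0;
  srs_p0 : p 0 = 0;
  srs_q0 : q 0 = 0 }.

Arguments srs_u {h sigma d a Q0 u v p q p' q'}.
Arguments srs_v {h sigma d a Q0 u v p q p' q'}.
Arguments srs_p {h sigma d a Q0 u v p q p' q'}.
Arguments srs_q {h sigma d a Q0 u v p q p' q'}.
Arguments srs_p' {h sigma d a Q0 u v p q p' q'}.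
Arguments srs_q' {h sigma d a Q0 u v p q p' q'}.
Arguments srs_re {h sigma d a Q0 u v p q p' q'}.
Arguments srs_im {h sigma d a Q0 u v p q p' q'}.
Arguments srs_u0 {h sigma d a Q0 u v p q p' q'}.
Arguments srs_v0 {h sigma d a Q0 u v p q p' q'}.
Arguments srs_p0 {h sigma d a Q0 u v p q p' q'}.
Arguments srs_q0 {h sigma d a Q0 u v p q p' q'}.

(** The regularity that survives when a profile, known on the half line only, is
    extended to the left by its value at 0: at 0 the extension is merely
    continuous.  The energy and uniqueness arguments need no more. *)
Record radial_solution (h : R -> R) (sigma d a Q0 : R) (u v p q : R -> R) : Prop := {
  rs_u_cont : forall x, 0 <= x -> continuous u x;
  rs_v_cont : forall x, 0 <= x -> continuous v x;
  rs_p_cont : forall x, 0 <= x -> continuous p x;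
  rs_q_cont : forall x, 0 <= x -> continuous q x;
  rs_u : forall x, 0 < x -> is_derive u x (p x);
  rs_v : forall x, 0 < x -> is_derive v x (q x);
  rs_p : forall x, 0 < x ->
    is_derive p x (force_re h sigma a x (u x) (v x) (q x) - (d - 1) / x * p x);
  rs_q : forall x, 0 < x ->
    is_derive q x (force_im h sigma a x (u x) (v x) (p x) - (d - 1) / x * q x);
  rs_u0 : u 0 = Q0;
  rs_v0 : v 0 = 0;
  rs_p0 : p 0 = 0;
  rs_q0 : q 0 = 0 }.

Arguments rs_u_cont {h sigma d a Q0 u v p q}.
Arguments rs_v_cont {h sigma d a Q0 u v p q}.
Arguments rs_p_cont {h sigma d a Q0 u v p q}.
Arguments rs_q_cont {h sigma d a Q0 u v p q}.
Arguments rs_u {h sigma d a Q0 u v p q}.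
Arguments rs_v {h sigma d a Q0 u v p q}.
Arguments rs_p {h sigma d a Q0 u v p q}.
Arguments rs_q {h sigma d a Q0 u v p q}.
Arguments rs_u0 {h sigma d a Q0 u v p q}.
Arguments rs_v0 {h sigma d a Q0 u v p q}.
Arguments rs_p0 {h sigma d a Q0 u v p q}.
Arguments rs_q0 {h sigma d a Q0 u v p q}.

Lemma smooth_radial_solution_weaken h sigma d a Q0 u v p q p' q' :
  smooth_radial_solution h sigma d a Q0 u v p q p' q' ->
  radial_solution h sigma d a Q0 u v p q.
Proof.
  intros S; split.
  - intros x Hx; exact (is_derive_continuous _ _ _ (srs_u S x Hx)).
  - intros x Hx; exact (is_derive_continuous _ _ _ (srs_v S x Hx)).
  - intros x Hx; exact (is_derive_continuous _ _ _ (srs_p S x Hx)).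
  - intros x Hx; exact (is_derive_continuous _ _ _ (srs_q S x Hx)).
  - intros x Hx; exact (srs_u S x (Rlt_le _ _ Hx)).
  - intros x Hx; exact (srs_v S x (Rlt_le _ _ Hx)).
  - intros x Hx; rewrite <- (srs_re S x Hx); exact (srs_p S x (Rlt_le _ _ Hx)).
  - intros x Hx; rewrite <- (srs_im S x Hx); exact (srs_q S x (Rlt_le _ _ Hx)).
  - exact (srs_u0 S).
  - exact (srs_v0 S).
  - exact (srs_p0 S).
  - exact (srs_q0 S).
Qed.

(** * Global solutions for Lipschitz nonlinearities *)

(** Chosen so that its logarithmic derivative 2 L (1 + s) is twice the Lipschitz
    constant of the forcing at s, which grows linearly because of the drift. *)
Definition picard_weight (L s : R) : R := exp (2 * L * (s + s * s / 2)).

Lemma picard_weight_derive (L s : R) :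
  is_derive (picard_weight L) s (2 * L * (1 + s) * picard_weight L s).
Proof.
  unfold picard_weight; auto_derive; [exact I|]. unfold Rdiv; field.
Qed.

Lemma picard_weight_continuous (L s : R) : continuous (picard_weight L) s.
Proof. eapply is_derive_continuous, picard_weight_derive. Qed.

Lemma picard_weight_integral (L b X : R) :
  RInt (fun s => b * (L * (1 + s)) * picard_weight L s) 0 X
    = b / 2 * (picard_weight L X - 1).
Proof.
  apply is_RInt_unique.
  replace (b / 2 * (picard_weight L X - 1))
    with (minus (b / 2 * picard_weight L X) (b / 2 * picard_weight L 0)).
  - apply (is_RInt_derive (V := R_CompleteNormedModule)
             (fun s => b / 2 * picard_weight L s)).
    + intros x _; evar_last.
      * apply (is_derive_scal (picard_weight L)), picard_weight_derive.
      * field.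
    + intros x _; generalize (picard_weight_continuous L x); intros; prove_continuous.
  - unfold minus, plus, opp; simpl; unfold picard_weight.
    replace (2 * L * (0 + 0 * 0 / 2)) with 0 by field; rewrite exp_0; ring.
Qed.

Lemma picard_weight_ge_1 (L s : R) : 0 <= L -> 0 <= s -> 1 <= picard_weight L s.
Proof.
  intros HL Hs; unfold picard_weight; rewrite <- exp_0 at 1.
  assert (H : 0 <= 2 * L * (s + s * s / 2)) by (apply Rmult_le_pos; nra).
  destruct H as [H|<-]; [left; apply exp_increasing, H|right; reflexivity].
Qed.

Lemma RInt_zero (a b : R) : RInt (fun _ => 0) a b = 0.
Proof.
  rewrite (RInt_const (V := R_CompleteNormedModule) a b 0); apply Rmult_0_r.
Qed.

Inductive component := Cu | Cv | Cp | Cq.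

Section Existence.
Variables (h : R -> R) (sigma d a Q0 K : R).
Hypothesis Hsigma : 0 < sigma.
Hypothesis Hd : 2 <= d.
Hypothesis Ha : 0 < a.
Hypothesis HK : 0 <= K.
Hypothesis Hh : forall x, continuous h x.
Hypothesis Hlip : forall u v u' v',
  Rabs (h (u * u + v * v) * u - h (u' * u' + v' * v') * u')
    <= K * (Rabs (u - u') + Rabs (v - v')).

Let picard_force_re (y : component -> R -> R) (s : R) :=
  force_re h sigma a s (y Cu s) (y Cv s) (y Cq s).
Let picard_force_im (y : component -> R -> R) (s : R) :=
  force_im h sigma a s (y Cu s) (y Cv s) (y Cp s).

(** Cutting the argument at 0 makes the iterates continuous on the whole line, so
    that every integrand is. *)
Let picard (y : component -> R -> R) (i : component) (x : R) : R :=
  let X := Rmax 0 x in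
  match i with
  | Cu => Q0 + RInt (y Cp) 0 X
  | Cv => RInt (y Cq) 0 X
  | Cp => X * weighted_average d (picard_force_re y) X
  | Cq => X * weighted_average d (picard_force_im y) X
  end.

Lemma picard_force_re_continuous y :
  (forall i x, continuous (y i) x) -> forall x, continuous (picard_force_re y) x.
Proof.
  intros Hy x; assert (H := fun i => Hy i x).
  unfold picard_force_re, force_re.
  assert (continuous (fun s => h (y Cu s * y Cu s + y Cv s * y Cv s)) x).
  { apply (continuous_Rcomp (fun s => y Cu s * y Cu s + y Cv s * y Cv s) h); [|apply Hh].
    prove_continuous; apply H. }
  prove_continuous; apply H.
Qed.

Lemma picard_force_im_continuous y :
  (forall i x, continuous (y i) x) -> forall x, continuous (picard_force_im y) x.
Proof.
  intros Hy x; assert (H := fun i => Hy i x).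
  unfold picard_force_im, force_im.
  assert (continuous (fun s => h (y Cu s * y Cu s + y Cv s * y Cv s)) x).
  { apply (continuous_Rcomp (fun s => y Cu s * y Cu s + y Cv s * y Cv s) h); [|apply Hh].
    prove_continuous; apply H. }
  prove_continuous; apply H.
Qed.

Lemma picard_continuous y :
  (forall i x, continuous (y i) x) -> forall i x, continuous (picard y i) x.
Proof.
  intros Hy i x.
  assert (Hi : forall f : R -> R, (forall z, continuous f z) ->
            continuous (fun z => RInt f 0 (Rmax 0 z)) x).
  { intros f Hf; apply (continuous_Rcomp (Rmax 0) (fun X => RInt f 0 X)).
    - apply continuous_Rmax_0.
    - eapply is_derive_continuous, is_derive_primitive, Hf. }
  assert (Hw : forall f : R -> R, (forall z, continuous f z) ->
            continuous (fun z => Rmax 0 z * weighted_average d f (Rmax 0 z)) x).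
  { intros f Hf; apply continuous_Rmult; [apply continuous_Rmax_0|].
    apply (continuous_Rcomp (Rmax 0) (weighted_average d f)).
    - apply continuous_Rmax_0.
    - apply weighted_average_continuous; assumption. }
  destruct i; unfold picard.
  - apply continuous_Rplus; [apply continuous_const|]. apply Hi, Hy.
  - apply Hi, Hy.
  - apply Hw, picard_force_re_continuous, Hy.
  - apply Hw, picard_force_im_continuous, Hy.
Qed.

Let L := 1 + a + a / sigma + 2 * K.

Lemma forces_lipschitz (y z : component -> R -> R) (s B : R) :
  0 <= s -> 0 <= B -> (forall i, Rabs (y i s - z i s) <= B) ->
  Rabs (picard_force_re y s - picard_force_re z s) <= L * (1 + s) * B /\
  Rabs (picard_force_im y s - picard_force_im z s) <= L * (1 + s) * B.
Proof.
  intros Hs HB Hyz; unfold picard_force_re, picard_force_im, force_re, force_im, L.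
  assert (Hu := Hyz Cu); assert (Hv := Hyz Cv).
  assert (Hp := Hyz Cp); assert (Hq := Hyz Cq).
  assert (G1 := Hlip (y Cu s) (y Cv s) (z Cu s) (z Cv s)).
  assert (G2 := Hlip (y Cv s) (y Cu s) (z Cv s) (z Cu s)).
  rewrite (Rplus_comm (y Cv s * y Cv s)), (Rplus_comm (z Cv s * z Cv s)) in G2.
  set (g1 := h _ * y Cu s) in *; set (g1' := h _ * z Cu s) in *.
  set (g2 := h _ * y Cv s) in *; set (g2' := h _ * z Cv s) in *.
  assert (Has : 0 < a / sigma) by (apply Rdiv_lt_0_compat; assumption).
  assert (E : forall r, a * (r / sigma) = a / sigma * r) by (intros; field; lra).
  assert (M1 : Rabs (g1 - g1') <= 2 * K * B) by nra.
  assert (M2 : Rabs (g2 - g2') <= 2 * K * B) by nra.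
  assert (M3 : forall r, Rabs r <= B -> Rabs (a / sigma * r) <= a / sigma * B).
  { intros r Hr; rewrite Rabs_mult, (Rabs_pos_eq (a / sigma)) by lra.
    apply Rmult_le_compat_l; lra. }
  assert (M4 : forall r, Rabs r <= B -> Rabs (a * s * r) <= a * s * B).
  { intros r Hr; rewrite Rabs_mult, (Rabs_pos_eq (a * s)) by nra.
    apply Rmult_le_compat_l; nra. }
  assert (Hfin : B + a / sigma * B + a * s * B + 2 * K * B
            <= (1 + a + a / sigma + 2 * K) * (1 + s) * B).
  { assert (0 <= B * s) by nra. assert (0 <= a / sigma * (B * s)) by nra.
    assert (0 <= K * (B * s)) by nra. nra. }
  split; eapply Rle_trans; try exact Hfin.
  - replace (_ - _) with ((y Cu s - z Cu s) + (a / sigma * (y Cv s - z Cv s)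
      + (a * s * (y Cq s - z Cq s) + - (g1 - g1')))) by (field; lra).
    eapply Rle_trans; [apply Rabs_triang|].
    eapply Rle_trans; [apply Rplus_le_compat_l, Rabs_triang|].
    eapply Rle_trans; [apply Rplus_le_compat_l, Rplus_le_compat_l, Rabs_triang|].
    rewrite Rabs_Ropp.
    specialize (M3 _ Hv); specialize (M4 _ Hq); lra.
  - replace (_ - _) with ((y Cv s - z Cv s) + (- (a / sigma * (y Cu s - z Cu s))
      + (- (a * s * (y Cp s - z Cp s)) + - (g2 - g2')))) by (field; lra).
    eapply Rle_trans; [apply Rabs_triang|].
    eapply Rle_trans; [apply Rplus_le_compat_l, Rabs_triang|].
    eapply Rle_trans; [apply Rplus_le_compat_l, Rplus_le_compat_l, Rabs_triang|].
    rewrite !Rabs_Ropp.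
    specialize (M3 _ Hu); specialize (M4 _ Hp); lra.
Qed.

Lemma growth_rate_ge_1 : 1 <= L.
Proof.
  unfold L; assert (0 < a / sigma) by (apply Rdiv_lt_0_compat; assumption); lra.
Qed.

(** Integrating the Lipschitz bound L (1 + s) b W(s) gives at most
    (b/2) W(x), by the choice of the weight. *)
Lemma picard_contraction (y z : component -> R -> R) (b : R) :
  (forall i x, continuous (y i) x) -> (forall i x, continuous (z i) x) -> 0 <= b ->
  (forall i x, Rabs (y i x - z i x) <= b * picard_weight L (Rmax 0 x)) ->
  forall i x, Rabs (picard y i x - picard z i x) <= b / 2 * picard_weight L (Rmax 0 x).
Proof.
  intros Hy Hz Hb Hyz i x.
  assert (HL := growth_rate_ge_1).
  set (X := Rmax 0 x); assert (HX : 0 <= X) by apply Rmax_l.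
  set (k := fun s => b * (L * (1 + s)) * picard_weight L s).
  assert (Hk : forall s, continuous k s).
  { intros s; unfold k; generalize (picard_weight_continuous L s); intros; prove_continuous. }
  assert (HkX : RInt k 0 X <= b / 2 * picard_weight L X).
  { unfold k; rewrite picard_weight_integral; nra. }
  assert (Hs : forall j s, 0 <= s -> Rabs (y j s - z j s) <= b * picard_weight L s).
  { intros j s H; specialize (Hyz j s); rewrite Rmax_right in Hyz by exact H; exact Hyz. }
  assert (Hw : forall s, 0 <= s -> 0 <= b * picard_weight L s).
  { intros s H; generalize (picard_weight_ge_1 L s ltac:(lra) H); nra. }
  assert (Hint : forall f g : R -> R, (forall s, continuous f s) -> (forall s, continuous g s) ->
     (forall s, 0 <= s -> Rabs (f s - g s) <= b * picard_weight L s) ->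
     Rabs (RInt f 0 X - RInt g 0 X) <= b / 2 * picard_weight L X).
  { intros f g Hf Hg Hfg; eapply Rle_trans; [|exact HkX].
    rewrite <- RInt_minus_continuous by assumption.
    assert (Hc : forall s, continuous (fun s => f s - g s) s)
      by (intros; apply continuous_Rminus; auto).
    eapply Rle_trans; [apply abs_RInt_le; [exact HX|apply ex_RInt_of_continuous, Hc]|].
    apply RInt_le; [exact HX| | |].
    - apply ex_RInt_of_continuous; intros s.
      apply (continuous_Rabs_comp (fun s => f s - g s)), Hc.
    - apply ex_RInt_of_continuous, Hk.
    - intros s Hs'; eapply Rle_trans; [apply Hfg; lra|].
      unfold k; specialize (Hw s ltac:(lra)).
      assert (1 <= L * (1 + s)) by nra. nra. }
  destruct i; unfold picard; fold X.
  - replace (_ - _) with (RInt (y Cp) 0 X - RInt (z Cp) 0 X) by ring.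
    apply Hint; auto.
  - apply Hint; auto.
  - eapply Rle_trans; [|exact HkX].
    apply weighted_average_diff_le; auto using picard_force_re_continuous.
    intros s Hs'; eapply Rle_trans.
    + apply (forces_lipschitz y z s (b * picard_weight L s)); try lra; auto.
      apply Hw; lra. intros j; apply Hs; lra.
    + unfold k; right; ring.
  - eapply Rle_trans; [|exact HkX].
    apply weighted_average_diff_le; auto using picard_force_im_continuous.
    intros s Hs'; eapply Rle_trans.
    + apply (forces_lipschitz y z s (b * picard_weight L s)); try lra; auto.
      apply Hw; lra. intros j; apply Hs; lra.
    + unfold k; right; ring.
Qed.

Lemma smooth_radial_solution_exists :
  exists u v p q p' q', smooth_radial_solution h sigma d a Q0 u v p q p' q'.
Proof.
  assert (HL := growth_rate_ge_1).
  destruct (weighted_fixed_point component (fun x => picard_weight L (Rmax 0 x))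
    picard (fun _ _ => 0) (Rabs Q0)) as [y [Hy Hfix]].
  - intros x; apply (continuous_Rcomp (Rmax 0) (picard_weight L)).
    + apply continuous_Rmax_0.
    + apply picard_weight_continuous.
  - intros x; left; apply exp_pos.
  - apply Rabs_pos.
  - intros; apply continuous_const.
  - apply picard_continuous.
  - apply picard_contraction.
  - intros i x; rewrite Rminus_0_r.
    assert (HX : 0 <= Rmax 0 x) by apply Rmax_l.
    assert (H1 := picard_weight_ge_1 L (Rmax 0 x) ltac:(lra) HX).
    assert (H0 : forall s, 0 <= s ->
              picard_force_re (fun _ _ => 0) s = 0 /\ picard_force_im (fun _ _ => 0) s = 0).
    { intros s Hs; unfold picard_force_re, picard_force_im, force_re, force_im; split; field; lra. }
    assert (Hz : forall f : R -> R, (forall s, continuous f s) -> (forall s, 0 <= s -> f s = 0) ->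
       Rabs (Rmax 0 x * weighted_average d f (Rmax 0 x)) <= 0).
    { intros f Hf Hf0.
      assert (H := weighted_average_diff_le d Hd f (fun s => 0 * f s) (fun _ => 0) (Rmax 0 x) Hf
         ltac:(intros; apply continuous_Rmult; auto using continuous_const)
         ltac:(intros; apply continuous_const) HX
         ltac:(intros s Hs; cbv beta; rewrite Hf0, Rmult_0_r, Rminus_diag, Rabs_R0 by lra; lra)).
      replace (weighted_average d (fun s => 0 * f s) (Rmax 0 x)) with 0 in H.
      - rewrite Rmult_0_r, Rminus_0_r in H.
        rewrite RInt_zero in H; exact H.
      - unfold weighted_average; destruct (Rlt_dec 0 (Rmax 0 x)) as [r|r].
        + transitivity (RInt (fun s => 0 * (rpow s (d - 1) * f s)) 0 (Rmax 0 x)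
                         / rpow (Rmax 0 x) d).
          * rewrite RInt_scal_continuous by (intros; apply continuous_weight; auto).
            unfold Rdiv; ring.
          * f_equal; apply (RInt_ext (V := R_CompleteNormedModule)); intros; simpl; ring.
        + field; lra. }
    assert (0 <= Rabs Q0 * picard_weight L (Rmax 0 x)) by (generalize (Rabs_pos Q0); nra).
    unfold picard; destruct i.
    + rewrite RInt_zero, Rplus_0_r.
      generalize (Rabs_pos Q0); nra.
    + rewrite RInt_zero, Rabs_R0; assumption.
    + eapply Rle_trans; [apply Hz|assumption]; [|apply H0].
      apply picard_force_re_continuous; intros; apply continuous_const.
    + eapply Rle_trans; [apply Hz|assumption]; [|apply H0].
      apply picard_force_im_continuous; intros; apply continuous_const.
  (* The fixed point is constant to the left of 0; dropping the cut-off in the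
     integral formulas gives functions differentiable on both sides of 0. *)
  - set (A := weighted_average d (picard_force_re y)); set (B := weighted_average d (picard_force_im y)).
    set (u := fun x => Q0 + RInt (y Cp) 0 x); set (v := fun x => RInt (y Cq) 0 x).
    assert (Hre := picard_force_re_continuous y Hy); assert (Him := picard_force_im_continuous y Hy).
    assert (Eu : forall x, 0 <= x -> y Cu x = u x).
    { intros x Hx; rewrite <- Hfix; unfold picard; rewrite Rmax_right by exact Hx; reflexivity. }
    assert (Ev : forall x, 0 <= x -> y Cv x = v x).
    { intros x Hx; rewrite <- Hfix; unfold picard; rewrite Rmax_right by exact Hx; reflexivity. }
    assert (Ep : forall x, 0 <= x -> y Cp x = x * A x).
    { intros x Hx; rewrite <- Hfix; unfold picard; rewrite Rmax_right by exact Hx; reflexivity. }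
    assert (Eq : forall x, 0 <= x -> y Cq x = x * B x).
    { intros x Hx; rewrite <- Hfix; unfold picard; rewrite Rmax_right by exact Hx; reflexivity. }
    exists u, v, (fun x => x * A x), (fun x => x * B x),
      (fun x => picard_force_re y x - (d - 1) * A x), (fun x => picard_force_im y x - (d - 1) * B x).
    split.
    + intros x Hx; rewrite <- Ep by exact Hx; unfold u; evar_last.
      * apply (is_derive_plus (fun _ => Q0) (fun x => RInt (y Cp) 0 x)).
        -- apply is_derive_const.
        -- apply is_derive_primitive, Hy.
      * apply plus_zero_l.
    + intros x Hx; rewrite <- Eq by exact Hx; apply is_derive_primitive, Hy.
    + intros x Hx; apply scaled_average_is_derive; assumption.
    + intros x Hx; apply scaled_average_is_derive; assumption.
    + intros x Hx; assert (continuous A x) by (apply weighted_average_continuous; assumption).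
      specialize (Hre x); prove_continuous.
    + intros x Hx; assert (continuous B x) by (apply weighted_average_continuous; assumption).
      specialize (Him x); prove_continuous.
    + intros x Hx; unfold picard_force_re; rewrite Eu, Ev, Eq by lra; field; lra.
    + intros x Hx; unfold picard_force_im; rewrite Eu, Ev, Ep by lra; field; lra.
    + unfold u; rewrite RInt_point; apply Rplus_0_r.
    + unfold v; rewrite RInt_point; reflexivity.
    + apply Rmult_0_l.
    + apply Rmult_0_l.
Qed.

End Existence.

(** * Energy growth and the Lyapunov function *)

(** The algebra behind x L' <= k L.  The variables stand for T = |w|^2, N = |Q|^2,
    H = H(N), hN = h(N) N, F = Re (Q' conj Q) and m = Im (w conj Q), and the left
    side is x times the derivative found in [lyapunov_derive].  The bound on m
    turns it into at most
      (1 - 1/sigma) (T + V) + (d/2) N - (d^2/2) F/x.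
    The surplus of k/2 over 1 - 1/sigma, at least 1/(2 sigma), absorbs the terms in
    N and F/x once x is large. *)
Lemma lyapunov_rate_le (sigma d a k x T N H hN F m : R) :
  0 < sigma -> 2 <= d -> 0 < a -> 0 <= d / 2 - 1 / sigma ->
  0 <= k <= 2 -> 1 / (2 * sigma) <= k / 2 - 1 + 1 / sigma ->
  1 <= x -> sigma * (d + d * d / 2) <= x ->
  8 * sigma * (1 + 2 * d + d * d / 2) <= a * a * (x * x) ->
  0 <= T -> 0 <= N -> 0 <= H -> 0 <= hN ->
  - (T + N) / 2 <= F -> a * x * m <= T + a * a * (x * x) / 4 * N ->
  x * (- (d - 1) / x * T + a * a * x / 4 * N + a * (d / 2 - 1 / sigma) * m
       + d / 2 * ((T - (d - 1) / x * F - (a * a * (x * x) / 4 - 1) * N - hN) / x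
                  - F / (x * x)))
  <= k * (T / 2 + (a * a * (x * x) / 4 - 1) * N / 2 + H / 2 + d / 2 * F / x).
Proof.
  intros Hs Hd Ha Hsc Hk Heta Hx1 Hx2 Hx3 HT HN HH HhN HF Hm.
  set (V := a * a * (x * x) / 4 * N) in *.
  set (g := F / x).
  set (sc := d / 2 - 1 / sigma) in *.
  set (r := 1 / (2 * sigma)) in *.
  assert (Hr : 0 < r) by (apply Rdiv_lt_0_compat; lra).
  assert (Hrs : r * sigma = 1 / 2) by (unfold r; field; lra).
  assert (E1 : 1 / sigma = 2 * r) by (unfold r; field; lra).
  assert (Hgx : g * x = F) by (unfold g; field; lra).
  match goal with |- ?l <= ?rr => 
    replace l with (- (d - 1) * T + V + sc * (a * x * m)
       + d / 2 * (T - V + N - hN - d * g)) by (unfold V, g, sc; field; lra);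
    replace rr with (k / 2 * (T + V - N + H) + k * d / 2 * g)
      by (unfold V, g; field; lra) end.
  assert (Hsc' : sc = d / 2 - 2 * r) by (unfold sc; rewrite E1; reflexivity).
  (* [Cc] collects the factors of F/x on both sides; the thresholds on x make
     Cc/(2x) <= r and 4 (1 + 2 d + d^2/2) N <= 4 r V, where r = 1/(2 sigma). *)
  set (Cc := k * d / 2 + d * d / 2).
  assert (HC : 0 <= Cc <= d + d * d / 2) by (unfold Cc; nra).
  assert (HCx : Cc <= 2 * r * x).
  { apply Rle_trans with (d + d * d / 2); [apply HC|].
    replace (d + d * d / 2) with (2 * r * (sigma * (d + d * d / 2))); [nra|].
    replace (2 * r * (sigma * (d + d * d / 2))) with (2 * (r * sigma) * (d + d * d / 2)) by ring.
    rewrite Hrs; field. }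
  assert (HV : 4 * (1 + 2 * d + d * d / 2) * N <= 4 * (r * V)).
  { unfold V. replace (4 * (r * (a * a * (x * x) / 4 * N)))
      with (r * (a * a * (x * x)) * N) by field.
    apply Rmult_le_compat_r; [exact HN|].
    replace (4 * (1 + 2 * d + d * d / 2))
      with (8 * (r * sigma) * (1 + 2 * d + d * d / 2)) by (rewrite Hrs; field).
    replace (8 * (r * sigma) * (1 + 2 * d + d * d / 2))
      with (r * (8 * sigma * (1 + 2 * d + d * d / 2))) by ring.
    apply Rmult_le_compat_l; lra. }
  assert (HCg : - (Cc * g) <= r * T + (d + d * d / 2) / 2 * N).
  { assert (- (g * x) <= (T + N) / 2) by lra.
    assert (Cc * (- g) <= Cc * ((T + N) / 2 / x)).
    { apply Rmult_le_compat_l; [apply HC|].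
      apply Rmult_le_reg_r with x; [lra|].
      replace ((T + N) / 2 / x * x) with ((T + N) / 2) by (field; lra). lra. }
    assert (Cc * ((T + N) / 2 / x) = Cc / x * (T / 2) + Cc / x * (N / 2)) by (field; lra).
    assert (Cc / x <= 2 * r).
    { apply Rmult_le_reg_r with x; [lra|].
      replace (Cc / x * x) with Cc by (field; lra). lra. }
    assert (Cc / x <= d + d * d / 2).
    { apply Rmult_le_reg_r with x; [lra|].
      replace (Cc / x * x) with Cc by (field; lra). nra. }
    nra. }
  assert (Hsm : sc * (a * x * m) <= sc * (T + V)) by (apply Rmult_le_compat_l; assumption).
  assert (HVp : 0 <= V) by (unfold V; apply Rmult_le_pos; [nra|exact HN]).
  assert (0 <= k / 2 * H) by nra.
  assert (0 <= d / 2 * hN) by nra.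
  assert (r * (T + V) <= (k / 2 - 1 + 2 * r) * (T + V)) by (rewrite E1 in Heta; nra).
  assert (k / 2 * N <= N) by nra.
  assert (0 <= d * N) by nra. assert (0 <= d * d * N) by nra.
  unfold Cc in HCg. rewrite Hsc' in *.
  nra.
Qed.

Lemma lyapunov_lower (d a x T N H F : R) :
  2 <= d -> 0 < a -> d <= x -> 16 <= a * a * (x * x) ->
  0 <= T -> 0 <= N -> 0 <= H -> - (T + N) / 2 <= F ->
  a * a * (x * x) / 16 * N
    <= T / 2 + (a * a * (x * x) / 4 - 1) * N / 2 + H / 2 + d / 2 * F / x.
Proof.
  intros Hd Ha Hx1 Hx2 HT HN HH HF.
  assert (Hg : - (T + N) / 4 <= d / 2 * F / x).
  { apply Rmult_le_reg_r with x; [lra|].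
    replace (d / 2 * F / x * x) with (d / 2 * F) by (field; lra).
    assert (d / 2 * (- (T + N) / 2) <= d / 2 * F) by (apply Rmult_le_compat_l; lra).
    nra. }
  nra.
Qed.

(** S stands for |Q'|^2: at a fixed x the Lyapunov function is controlled by the
    energy of [energy_growth]. *)
Lemma lyapunov_upper (d a x S T N H F : R) :
  2 <= d -> 1 <= x ->
  0 <= S -> 0 <= N -> 0 <= H -> T <= 2 * S + a * a * (x * x) / 2 * N ->
  0 <= T -> F <= (T + N) / 2 ->
  T / 2 + (a * a * (x * x) / 4 - 1) * N / 2 + H / 2 + d / 2 * F / x
    <= (2 + d + (d + 1) * (a * a * (x * x))) * ((S + N) / 2 + H / 2).
Proof.
  intros Hd Hx HS HN HH HT HT0 HF.
  assert (Hg : d / 2 * F / x <= d * (T + N) / 4).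
  { apply Rmult_le_reg_r with x; [lra|].
    replace (d / 2 * F / x * x) with (d / 2 * F) by (field; lra).
    assert (d / 2 * F <= d / 2 * ((T + N) / 2)) by (apply Rmult_le_compat_l; lra).
    assert (0 <= d * (T + N)) by nra. nra. }
  set (b := a * a * (x * x)) in *.
  assert (0 <= b) by (unfold b; nra).
  assert (d * T <= d * (2 * S + b / 2 * N)) by (apply Rmult_le_compat_l; lra).
  assert (0 <= d * S) by nra. assert (0 <= b * S) by nra. assert (0 <= b * H) by nra.
  assert (0 <= b * N) by nra. assert (0 <= d * (b * N)) by nra.
  assert (0 <= d * (b * S)) by nra. assert (0 <= d * (b * H)) by nra.
  assert (0 <= d * N) by nra. assert (0 <= d * H) by nra.
  nra.
Qed.

Section Apriori.
Variables (h H : R -> R) (sigma d a Q0 : R) (u v p q : R -> R).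
Hypothesis Hsigma : 0 < sigma.
Hypothesis Hd : 2 <= d.
Hypothesis Ha : 0 < a.
Hypothesis Hh : forall s, 0 <= h s.
Hypothesis HH : forall s, is_derive H s (h s).
Hypothesis HH0 : forall s, 0 <= s -> 0 <= H s.
Hypothesis Sol : radial_solution h sigma d a Q0 u v p q.

Let N x := u x * u x + v x * v x.
Let E x := (p x * p x + q x * q x + N x) / 2 + H (N x) / 2.

Lemma modulus_nonneg x : 0 <= N x.
Proof. unfold N; nra. Qed.

Lemma potential_nonneg x : 0 <= H (N x).
Proof. apply HH0, modulus_nonneg. Qed.

Lemma potential_continuous x : 0 <= x -> continuous (fun y => H (N y)) x.
Proof.
  intros Hx; apply (continuous_Rcomp N H).
  - unfold N; generalize (rs_u_cont Sol x Hx) (rs_v_cont Sol x Hx); intros; prove_continuous.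
  - exact (is_derive_continuous _ _ _ (HH (N x))).
Qed.

Lemma energy_continuous x : 0 <= x -> continuous E x.
Proof.
  intros Hx; unfold E; generalize (potential_continuous x Hx); unfold N.
  generalize (rs_u_cont Sol x Hx) (rs_v_cont Sol x Hx)
    (rs_p_cont Sol x Hx) (rs_q_cont Sol x Hx); intros; prove_continuous.
Qed.

Lemma energy_derive x : 0 < x ->
  is_derive E x (2 * (p x * u x + q x * v x)
    + a / sigma * (p x * v x - q x * u x) - (d - 1) / x * (p x * p x + q x * q x)).
Proof.
  intros Hx; unfold E, N.
  assert (Du := rs_u Sol x Hx); assert (Dv := rs_v Sol x Hx).
  assert (Dp := rs_p Sol x Hx); assert (Dq := rs_q Sol x Hx).
  assert (DH := HH (u x * u x + v x * v x)).
  auto_derive.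
  - repeat split; first [exact I | eexists; eassumption].
  - fold_derivatives; unfold force_re, force_im; field; lra.
Qed.

(** The friction term only dissipates and the drift i a x Q' is orthogonal to Q';
    what is left of the derivative is bounded by (2 + a/sigma) E, with a rate that
    does not see h. *)
Lemma energy_growth x : 0 <= x -> E x <= E 0 * exp ((2 + a / sigma) * x).
Proof.
  intros Hx; eapply gronwall; [exact Hx|exact energy_continuous| |].
  - intros y Hy; apply energy_derive; lra.
  - intros y Hy; cbv beta.
    assert (0 < a / sigma) by (apply Rdiv_lt_0_compat; assumption).
    assert (0 <= (d - 1) / y) by (apply Rmult_le_pos; [lra|left; apply Rinv_0_lt_compat; lra]).
    assert (HNy := potential_nonneg y); unfold E, N in *.
    set (P := p y) in *; set (Q := q y) in *; set (U := u y) in *; set (V := v y) in *.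
    assert (0 <= (d - 1) / y * (P * P + Q * Q)) by (apply Rmult_le_pos; nra).
    assert (2 * (P * U + Q * V) <= P * P + Q * Q + (U * U + V * V))
      by (generalize (Rle_0_sqr (P - U)) (Rle_0_sqr (Q - V)); unfold Rsqr; lra).
    assert (a / sigma * (P * V - Q * U) <= a / sigma * ((P * P + Q * Q + (U * U + V * V)) / 2))
      by (apply Rmult_le_compat_l;
          [lra|generalize (Rle_0_sqr (P - V)) (Rle_0_sqr (Q + U)); unfold Rsqr; lra]).
    assert (0 <= a / sigma * H (U * U + V * V)) by (apply Rmult_le_pos; lra).
    nra.
Qed.

Let F x := p x * u x + q x * v x.
Let T x := (p x - a * x / 2 * v x) * (p x - a * x / 2 * v x)
         + (q x + a * x / 2 * u x) * (q x + a * x / 2 * u x).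
Let M x := (q x + a * x / 2 * u x) * u x - (p x - a * x / 2 * v x) * v x.

Let lyapunov x :=
  T x / 2 + (a * a * (x * x) / 4 - 1) * N x / 2 + H (N x) / 2 + d / 2 * F x / x.

Lemma lyapunov_derive x : 0 < x ->
  is_derive lyapunov x
    (- (d - 1) / x * T x + a * a * x / 4 * N x + a * (d / 2 - 1 / sigma) * M x
     + d / 2 * ((T x - (d - 1) / x * F x - (a * a * (x * x) / 4 - 1) * N x
                 - h (N x) * N x) / x - F x / (x * x))).
Proof.
  intros Hx; unfold lyapunov, T, F, M, N.
  assert (Du := rs_u Sol x Hx); assert (Dv := rs_v Sol x Hx).
  assert (Dp := rs_p Sol x Hx); assert (Dq := rs_q Sol x Hx).
  assert (DH := HH (u x * u x + v x * v x)).
  auto_derive.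
  - repeat split; first [exact I | eexists; eassumption | lra].
  - fold_derivatives; unfold force_re, force_im; field; lra.
Qed.

Lemma chirp_nonneg x : 0 <= T x.
Proof. unfold T; apply Rplus_le_le_0_compat; apply Rle_0_sqr. Qed.

(** Re (Q' conj Q) = Re (w conj Q), because w - Q' is an imaginary multiple
    of Q. *)
Lemma flux_bounds x : - (T x + N x) / 2 <= F x <= (T x + N x) / 2.
Proof.
  unfold T, N, F.
  set (P := p x - a * x / 2 * v x); set (Q := q x + a * x / 2 * u x).
  replace (p x * u x + q x * v x) with (P * u x + Q * v x) by (unfold P, Q; ring).
  generalize (Rle_0_sqr (P - u x)) (Rle_0_sqr (Q - v x))
    (Rle_0_sqr (P + u x)) (Rle_0_sqr (Q + v x)); unfold Rsqr; lra.
Qed.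

(** The inequality x L' <= k L says that x^(-k) L is nonincreasing; the power is
    written as an exponential of ln x. *)
Lemma lyapunov_decay k x0 x :
  0 <= d / 2 - 1 / sigma -> 0 <= k <= 2 -> 1 / (2 * sigma) <= k / 2 - 1 + 1 / sigma ->
  1 <= x0 -> sigma * (d + d * d / 2) <= x0 ->
  8 * sigma * (1 + 2 * d + d * d / 2) <= a * a * (x0 * x0) ->
  x0 <= x ->
  lyapunov x * exp (- k * ln x) <= lyapunov x0 * exp (- k * ln x0).
Proof.
  intros Hsc Hk Heta Hx1 Hx2 Hx3 Hx.
  assert (Dl : forall y, 0 < y -> is_derive (fun y => lyapunov y * exp (- k * ln y)) y
     ((Derive lyapunov y - k * lyapunov y / y) * exp (- k * ln y))).
  { intros y Hy; assert (L := lyapunov_derive y Hy); auto_derive.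
    - repeat split; [eexists; exact L|exact Hy].
    - change (Derive (fun x => lyapunov x) y) with (Derive lyapunov y); field; lra. }
  eapply (nonincreasing_of_derive (fun y => lyapunov y * exp (- k * ln y)) _ x0 x Hx).
  - intros y Hy; exact (is_derive_continuous _ _ _ (Dl y ltac:(lra))).
  - intros y Hy; apply Dl; lra.
  - intros y Hy; cbv beta.
    assert (L := is_derive_unique _ _ _ (lyapunov_derive y ltac:(lra))).
    assert (Hle : y * Derive lyapunov y <= k * lyapunov y).
    { rewrite L; unfold lyapunov; apply lyapunov_rate_le; try assumption; try lra.
      - assert (x0 * x0 <= y * y) by nra.
        eapply Rle_trans; [exact Hx3|]; apply Rmult_le_compat_l; [nra|lra].
      - apply chirp_nonneg.
      - apply modulus_nonneg.
      - apply potential_nonneg.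
      - apply Rmult_le_pos; [apply Hh|apply modulus_nonneg].
      - apply flux_bounds.
      (* This is |w - i (a y/2) Q|^2 >= 0, expanded. *)
      - unfold M, T, N.
        set (P := p y - _); set (Q := q y + _).
        generalize (Rle_0_sqr (P + a * y / 2 * v y))
          (Rle_0_sqr (Q - a * y / 2 * u y)); unfold Rsqr; lra. }
    assert (Derive lyapunov y - k * lyapunov y / y <= 0).
    { apply Rmult_le_reg_l with y; [lra|].
      replace (y * (Derive lyapunov y - k * lyapunov y / y))
        with (y * Derive lyapunov y - k * lyapunov y) by (field; lra). lra. }
    generalize (exp_pos (- k * ln y)); nra.
Qed.

(** From a^2 x^2 N/16 <= L <= L(x0) x^k and the energy bound of L(x0).  The
    constant depends on h only through the initial energy. *)
Lemma modulus_decay k x0 e0 x :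
  0 <= d / 2 - 1 / sigma -> 0 <= k <= 2 -> 1 / (2 * sigma) <= k / 2 - 1 + 1 / sigma ->
  1 <= x0 -> d <= x0 -> sigma * (d + d * d / 2) <= x0 ->
  8 * sigma * (1 + 2 * d + d * d / 2) <= a * a * (x0 * x0) ->
  16 <= a * a * (x0 * x0) ->
  E 0 <= e0 -> x0 <= x ->
  N x <= 16 / (a * a) * ((2 + d + (d + 1) * (a * a * (x0 * x0)))
                         * (e0 * exp ((2 + a / sigma) * x0)))
         * exp (- (2 - k) * ln x).
Proof.
  intros Hsc Hk Heta H1 H2 H3 H4 H5 He Hx.
  assert (Hup : lyapunov x0 <= (2 + d + (d + 1) * (a * a * (x0 * x0)))
                         * (e0 * exp ((2 + a / sigma) * x0))).
  { apply Rle_trans with ((2 + d + (d + 1) * (a * a * (x0 * x0))) * E x0).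
    - unfold E; replace ((p x0 * p x0 + q x0 * q x0 + N x0) / 2)
        with (((p x0 * p x0 + q x0 * q x0) + N x0) / 2) by ring.
      apply lyapunov_upper; auto using modulus_nonneg, potential_nonneg, chirp_nonneg.
      + nra.
      + unfold T, N.
        assert (G : forall r s, (r + s) * (r + s) <= 2 * (r * r) + 2 * (s * s))
          by (intros r s; generalize (Rle_0_sqr (r - s)); unfold Rsqr; lra).
        assert (G1 := G (p x0) (- (a * x0 / 2 * v x0))).
        assert (G2 := G (q x0) (a * x0 / 2 * u x0)).
        lra.
      + apply flux_bounds.
    - apply Rmult_le_compat_l; [assert (0 <= a * a * (x0 * x0)) by lra; nra|].
      eapply Rle_trans; [apply energy_growth; lra|].
      apply Rmult_le_compat_r; [left; apply exp_pos|exact He]. }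
  assert (Hlow : a * a * (x * x) / 16 * N x <= lyapunov x).
  { apply lyapunov_lower; auto using modulus_nonneg, potential_nonneg, chirp_nonneg; try lra.
    - assert (x0 * x0 <= x * x) by nra. nra.
    - apply flux_bounds. }
  assert (Hlow0 : 0 <= lyapunov x0).
  { apply Rle_trans with (a * a * (x0 * x0) / 16 * N x0).
    - apply Rmult_le_pos; [lra|apply modulus_nonneg].
    - apply lyapunov_lower; auto using modulus_nonneg, potential_nonneg, chirp_nonneg; try lra.
      apply flux_bounds. }
  assert (Hdec := lyapunov_decay k x0 x Hsc Hk Heta H1 H3 H4 Hx).
  assert (Hln : exp (- k * ln x0) <= 1).
  { rewrite <- exp_0.
    assert (0 <= ln x0) by (rewrite <- ln_1; apply ln_le; lra).
    assert (Hk0 : - k * ln x0 <= 0) by nra.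
    destruct (Rle_lt_or_eq_dec _ _ Hk0) as [Hl| ->]; [left; apply exp_increasing, Hl|lra]. }
  set (C := _ * (e0 * _)) in *.
  assert (Hxx : x * x = exp (2 * ln x)).
  { replace (2 * ln x) with (ln x + ln x) by ring.
    rewrite exp_plus, exp_ln by lra; reflexivity. }
  assert (Hsplit : exp (- (2 - k) * ln x) * (exp (- k * ln x) * (x * x)) = 1).
  { rewrite Hxx, <- !exp_plus, <- exp_0; f_equal; ring. }
  assert (0 < exp (- k * ln x)) by apply exp_pos.
  assert (0 < exp (- (2 - k) * ln x)) by apply exp_pos.
  assert (Hfin : a * a * (x * x) / 16 * N x * exp (- k * ln x) <= C).
  { apply Rle_trans with (lyapunov x * exp (- k * ln x)).
    - apply Rmult_le_compat_r; lra.
    - apply Rle_trans with (1 := Hdec). nra. }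
  apply (Rmult_le_compat_r (exp (- (2 - k) * ln x))) in Hfin; [|lra].
  replace (a * a * (x * x) / 16 * N x * exp (- k * ln x) * exp (- (2 - k) * ln x))
    with (a * a / 16 * N x * (exp (- (2 - k) * ln x) * (exp (- k * ln x) * (x * x))))
    in Hfin by field.
  rewrite Hsplit, Rmult_1_r in Hfin.
  apply (Rmult_le_compat_l (16 / (a * a))) in Hfin.
  - replace (16 / (a * a) * (a * a / 16 * N x)) with (N x) in Hfin by (field; lra).
    lra.
  - left; apply Rdiv_lt_0_compat; nra.
Qed.

Lemma energy_0 : E 0 = Q0 * Q0 / 2 + H (Q0 * Q0) / 2.
Proof.
  unfold E, N; rewrite (rs_u0 Sol), (rs_v0 Sol), (rs_p0 Sol), (rs_q0 Sol).
  replace (Q0 * Q0 + 0 * 0) with (Q0 * Q0) by ring; field.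
Qed.

Lemma modulus_growth x0 e0 x :
  E 0 <= e0 -> 0 <= x <= x0 -> N x <= 2 * (e0 * exp ((2 + a / sigma) * x0)).
Proof.
  intros He Hx.
  assert (Hg := energy_growth x (proj1 Hx)).
  assert (H0 : 0 <= E 0) by (unfold E; generalize (potential_nonneg 0) (modulus_nonneg 0); nra).
  assert (HNE : N x <= 2 * E x).
  { unfold E; generalize (potential_nonneg x) (Rle_0_sqr (p x)) (Rle_0_sqr (q x)).
    unfold Rsqr; lra. }
  assert (Has : 0 < a / sigma) by (apply Rdiv_lt_0_compat; assumption).
  assert (Hexp : exp ((2 + a / sigma) * x) <= exp ((2 + a / sigma) * x0)).
  { destruct (Rle_lt_or_eq_dec _ _ (proj2 Hx)) as [Hlt| ->]; [|lra].
    left; apply exp_increasing, Rmult_lt_compat_l; lra. }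
  assert (E 0 * exp ((2 + a / sigma) * x) <= e0 * exp ((2 + a / sigma) * x0)).
  { apply Rmult_le_compat; try lra; left; apply exp_pos. }
  lra.
Qed.

End Apriori.

(** * The truncated power nonlinearity *)

Definition power_nonlinearity (sigma s : R) : R := rpow s sigma.

(** The nonlinearity is a function of N = |Q|^2, so the exponent is sigma and the
    cut-off at K acts on the square of the modulus. *)
Definition truncated_power (sigma K s : R) : R := rpow (Rmin s K) sigma.

Lemma truncated_power_eq (sigma K s : R) :
  s <= K -> truncated_power sigma K s = rpow s sigma.
Proof. intros H; unfold truncated_power; rewrite Rmin_left by exact H; reflexivity. Qed.

Lemma continuous_Rmin_r (K x : R) : continuous (fun s => Rmin s K) x.
Proof.
  apply continuous_epsilon; intros eps He; exists eps; split; [exact He|].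
  intros y Hy; revert Hy; unfold Rmin, Rabs.
  destruct (Rle_dec y K), (Rle_dec x K); repeat destruct Rcase_abs; lra.
Qed.

Lemma truncated_power_continuous (sigma K x : R) :
  0 < sigma -> continuous (truncated_power sigma K) x.
Proof.
  intros Hs; apply (continuous_Rcomp (fun s => Rmin s K) (fun s => rpow s sigma)).
  - apply continuous_Rmin_r.
  - apply rpow_continuous, Hs.
Qed.

Lemma truncated_power_le (sigma K s : R) :
  0 < sigma -> truncated_power sigma K s <= rpow K sigma.
Proof. intros Hs; apply rpow_le; [lra|apply Rmin_r]. Qed.

(** The modulus r |-> min(r^2, K)^sigma has slope at most 2 sigma K^sigma / s beyond
    s; the factor s compensates the blow-up of that slope near 0 when
    sigma < 1/2. *)
Lemma truncated_power_slope (sigma K s r : R) :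
  0 < sigma -> 0 <= s <= r ->
  s * (truncated_power sigma K (r * r) - truncated_power sigma K (s * s))
    <= 2 * sigma * rpow K sigma * (r - s).
Proof.
  intros Hs Hsr.
  assert (HA := rpow_nonneg K sigma).
  assert (H0 : 0 <= 2 * sigma * rpow K sigma * (r - s)).
  { repeat apply Rmult_le_pos; lra. }
  destruct (Rle_dec K (s * s)) as [HK|HK].
  { unfold truncated_power; rewrite !Rmin_right by nra. rewrite Rminus_diag; lra. }
  destruct (Rle_lt_or_eq_dec 0 s (proj1 Hsr)) as [Hs0|<-]; [|lra].
  assert (HK0 : 0 < K) by nra.
  (* Beyond sqrt K the truncated power is constant, so r may be replaced by r1. *)
  set (r1 := Rmin r (sqrt K)).
  assert (HsK : s <= sqrt K).
  { rewrite <- (sqrt_Rsqr s) by lra; apply sqrt_le_1_alt; unfold Rsqr; lra. }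
  assert (Hr1 : s <= r1 <= r) by (unfold r1; split; [apply Rmin_glb; lra|apply Rmin_l]).
  assert (Hr1K : r1 * r1 = Rmin (r * r) K).
  { unfold r1; destruct (Rle_dec r (sqrt K)) as [H|H].
    - rewrite Rmin_left by exact H; rewrite Rmin_left; [reflexivity|].
      rewrite <- (sqrt_sqrt K) by lra; nra.
    - rewrite Rmin_right by lra; rewrite sqrt_sqrt, Rmin_right; try lra.
      rewrite <- (sqrt_sqrt K) by lra; generalize (sqrt_pos K); nra. }
  unfold truncated_power; rewrite <- Hr1K, (Rmin_left (s * s)) by lra.
  rewrite !rpow_sqr, (rpow_pos_eq r1), (rpow_pos_eq s) by lra.
  destruct (MVT_gen (fun t => Rpower t (2 * sigma)) s r1
              (fun t => 2 * sigma * Rpower t (2 * sigma) / t)) as [c [Hc Heq]].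
  - rewrite Rmin_left, Rmax_right by lra; intros t Ht; apply is_derive_Rpower; lra.
  - rewrite Rmin_left, Rmax_right by lra; intros t Ht.
    apply continuity_pt_filterlim.
    exact (is_derive_continuous _ _ _ (is_derive_Rpower (2 * sigma) t ltac:(lra))).
  - rewrite Rmin_left, Rmax_right in Hc by lra.
    rewrite Heq.
    assert (Hcp : Rpower c (2 * sigma) <= rpow K sigma).
    { rewrite <- rpow_pos_eq, <- rpow_sqr by lra; apply rpow_le; [lra|].
      apply Rle_trans with (r1 * r1); [nra|rewrite Hr1K; apply Rmin_r]. }
    assert (0 < Rpower c (2 * sigma)) by apply exp_pos.
    assert (Hsc : 0 <= s / c <= 1).
    { split; [apply Rmult_le_pos; [lra|left; apply Rinv_0_lt_compat; lra]|].
      apply Rmult_le_reg_r with c; [lra|]; unfold Rdiv; rewrite Rmult_assoc, Rinv_l; lra. }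
    replace (s * (2 * sigma * Rpower c (2 * sigma) / c * (r1 - s)))
      with (2 * sigma * (s / c * Rpower c (2 * sigma)) * (r1 - s)) by (field; lra).
    apply Rmult_le_compat; try lra.
    + apply Rmult_le_pos; [lra|]; apply Rmult_le_pos; lra.
    + apply Rmult_le_compat_l; [lra|].
      apply Rle_trans with (1 * Rpower c (2 * sigma)); [|lra].
      apply Rmult_le_compat_r; lra.
Qed.

Lemma Cmod_le_sum (x y : R) : Cmod (x, y) <= Rabs x + Rabs y.
Proof.
  unfold Cmod; simpl fst; simpl snd.
  rewrite <- (sqrt_Rsqr (Rabs x + Rabs y))
    by (generalize (Rabs_pos x) (Rabs_pos y); lra).
  apply sqrt_le_1_alt.
  rewrite <- (pow2_abs x), <- (pow2_abs y); unfold Rsqr.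
  generalize (Rabs_pos x) (Rabs_pos y); nra.
Qed.

Lemma Cmod_sqr (x y : R) : Cmod (x, y) * Cmod (x, y) = x * x + y * y.
Proof.
  unfold Cmod; simpl fst; simpl snd; rewrite sqrt_sqrt; [ring|nra].
Qed.

(** With r = |z| >= s = |z'| and g(r) the truncated power at r^2, split
    g(r) z - g(s) z' = g(r) (z - z') + (g(r) - g(s)) z'; the second term is
    controlled by [truncated_power_slope]. *)
Lemma truncated_power_lipschitz (sigma K u v u' v' : R) :
  0 < sigma ->
  Rabs (truncated_power sigma K (u * u + v * v) * u
        - truncated_power sigma K (u' * u' + v' * v') * u')
    <= (1 + 2 * sigma) * rpow K sigma * (Rabs (u - u') + Rabs (v - v')).
Proof.
  intros Hs.
  assert (Hmain : forall u v u' v', Cmod (u', v') <= Cmod (u, v) ->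
     Rabs (truncated_power sigma K (u * u + v * v) * u
        - truncated_power sigma K (u' * u' + v' * v') * u')
    <= (1 + 2 * sigma) * rpow K sigma * (Rabs (u - u') + Rabs (v - v'))).
  { clear u v u' v'; intros u v u' v' Hle.
    rewrite <- !Cmod_sqr.
    set (r := Cmod (u, v)) in *; set (s := Cmod (u', v')) in *.
    assert (Hs0 : 0 <= s) by apply Cmod_ge_0.
    assert (Hslope := truncated_power_slope sigma K s r Hs (conj Hs0 Hle)).
    assert (Hr := truncated_power_le sigma K (r * r) Hs).
    assert (Hr0 : 0 <= truncated_power sigma K (r * r)) by apply rpow_nonneg.
    assert (Hmono : truncated_power sigma K (s * s) <= truncated_power sigma K (r * r)).
    { apply rpow_le; [lra|]; apply Rle_min_compat_r; nra. }
    assert (Hdist : r - s <= Rabs (u - u') + Rabs (v - v')).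
    { assert (H := Cmod_triangle (u', v') (u - u', v - v')).
      replace (Cplus (u', v') (u - u', v - v')) with (u, v) in H
        by (unfold Cplus; simpl; f_equal; ring).
      assert (H' := Cmod_le_sum (u - u') (v - v')).
      unfold r, s; lra. }
    assert (Hu' : Rabs u' <= s).
    { eapply Rle_trans; [|apply (re_le_Cmod (u', v'))]; apply Rle_refl. }
    set (er := truncated_power sigma K (r * r)) in *.
    set (es := truncated_power sigma K (s * s)) in *.
    replace (er * u - es * u') with (er * (u - u') + (er - es) * u') by ring.
    eapply Rle_trans; [apply Rabs_triang|]; rewrite !Rabs_mult.
    rewrite (Rabs_pos_eq er), (Rabs_pos_eq (er - es)) by lra.
    assert ((er - es) * Rabs u' <= (er - es) * s) by (apply Rmult_le_compat_l; lra).
    assert (er * Rabs (u - u') <= rpow K sigma * (Rabs (u - u') + Rabs (v - v'))).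
    { apply Rmult_le_compat; try lra; [apply Rabs_pos|].
      generalize (Rabs_pos (v - v')); lra. }
    assert (2 * sigma * rpow K sigma * (r - s)
       <= 2 * sigma * rpow K sigma * (Rabs (u - u') + Rabs (v - v'))).
    { apply Rmult_le_compat_l; [|exact Hdist].
      apply Rmult_le_pos; [lra|apply rpow_nonneg]. }
    lra. }
  destruct (Rle_dec (Cmod (u', v')) (Cmod (u, v))) as [H|H].
  - apply Hmain, H.
  - rewrite Rabs_minus_sym, (Rabs_minus_sym u), (Rabs_minus_sym v); apply Hmain; lra.
Qed.

Lemma truncated_primitive_nonneg (sigma K s : R) :
  0 < sigma -> 0 <= s -> 0 <= RInt (truncated_power sigma K) 0 s.
Proof.
  intros Hs H0; apply RInt_ge_0; [exact H0| |].
  - apply ex_RInt_of_continuous; intros; apply truncated_power_continuous, Hs.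
  - intros; apply rpow_nonneg.
Qed.

(** Bounds the initial energy independently of the truncation height. *)
Lemma truncated_primitive_le (sigma K s : R) :
  0 < sigma -> 0 <= s -> RInt (truncated_power sigma K) 0 s <= s * rpow s sigma.
Proof.
  intros Hs H0; eapply Rle_trans; [apply Rle_abs|].
  replace (s * rpow s sigma) with ((s - 0) * rpow s sigma) by ring.
  apply abs_RInt_le_const; [exact H0| |].
  - apply ex_RInt_of_continuous; intros; apply truncated_power_continuous, Hs.
  - intros t Ht; rewrite Rabs_pos_eq by apply rpow_nonneg.
    apply rpow_le; [lra|]; eapply Rle_trans; [apply Rmin_l|lra].
Qed.

(** * Existence of a decaying solution *)

(** The rate is k = max(0, 2 - 1/sigma): it is below 2, nonnegative so that the
    potential term H may be dropped, and k/2 exceeds 1 - 1/sigma by at least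
    1/(2 sigma). *)
Lemma lyapunov_constants (sigma d a : R) :
  0 < sigma -> 2 <= d -> 0 < a ->
  exists k x0, 0 <= k < 2 /\ 1 / (2 * sigma) <= k / 2 - 1 + 1 / sigma /\
    1 <= x0 /\ d <= x0 /\ sigma * (d + d * d / 2) <= x0 /\
    8 * sigma * (1 + 2 * d + d * d / 2) <= a * a * (x0 * x0) /\
    16 <= a * a * (x0 * x0).
Proof.
  intros Hs Hd Ha.
  assert (Hi : 0 < 1 / sigma) by (apply Rdiv_lt_0_compat; lra).
  assert (H2 : 1 / (2 * sigma) = 1 / sigma / 2) by (field; lra).
  assert (Haa : 0 < a * a) by nra.
  set (c1 := sigma * (d + d * d / 2)).
  set (c2 := 8 * sigma * (1 + 2 * d + d * d / 2)).
  assert (Hc1 : 0 < c1) by (unfold c1; apply Rmult_lt_0_compat; nra).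
  assert (Hc2 : 0 < c2) by (unfold c2; apply Rmult_lt_0_compat; nra).
  assert (Hc2' : 0 < c2 / (a * a)) by (apply Rdiv_lt_0_compat; assumption).
  assert (Hc3 : 0 < 16 / (a * a)) by (apply Rdiv_lt_0_compat; lra).
  exists (Rmax 0 (2 - 1 / sigma)), (1 + d + c1 + c2 / (a * a) + 16 / (a * a)).
  set (x0 := 1 + d + c1 + c2 / (a * a) + 16 / (a * a)).
  assert (Hx0 : 1 + c2 / (a * a) + 16 / (a * a) <= x0) by (unfold x0; lra).
  assert (Hxx : a * a * x0 <= a * a * (x0 * x0)) by (apply Rmult_le_compat_l; nra).
  assert (Hax : a * a * (c2 / (a * a) + 16 / (a * a)) <= a * a * x0)
    by (apply Rmult_le_compat_l; lra).
  replace (a * a * (c2 / (a * a) + 16 / (a * a))) with (c2 + 16) in Hax by (field; lra).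
  repeat split; try lra; try (unfold x0; lra).
  - apply Rmax_l.
  - apply Rmax_lub_lt; lra.
  - rewrite H2; generalize (Rmax_l 0 (2 - 1 / sigma)) (Rmax_r 0 (2 - 1 / sigma)); lra.
Qed.

Lemma power_decay_to_0 (C b eps : R) :
  0 < b -> 0 < eps -> exists M, forall x, M < x -> C * exp (- b * ln x) < eps.
Proof.
  intros Hb He.
  assert (HC : 0 < Rabs C + 1) by (generalize (Rabs_pos C); lra).
  set (t := ln (eps / (Rabs C + 1))).
  exists (exp (- t / b)); intros x Hx.
  assert (Hl : - t / b < ln x) by (rewrite <- (ln_exp (- t / b)); apply ln_increasing; [apply exp_pos|exact Hx]).
  apply (Rmult_lt_compat_l b) in Hl; [|exact Hb].
  replace (b * (- t / b)) with (- t) in Hl by (field; lra).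
  assert (Hexp : exp (- b * ln x) < eps / (Rabs C + 1)).
  { rewrite <- (exp_ln (eps / (Rabs C + 1))) by (apply Rdiv_lt_0_compat; assumption).
    apply exp_increasing; fold t; lra. }
  apply (Rmult_lt_compat_l (Rabs C + 1)) in Hexp; [|exact HC].
  replace ((Rabs C + 1) * (eps / (Rabs C + 1))) with eps in Hexp by (field; lra).
  generalize (Rle_abs C) (exp_pos (- b * ln x)); nra.
Qed.

(** The bound K is computed first, from quantities that do not involve the
    truncation: e0 bounds the initial energy, 2 G bounds N up to x0, and B beyond
    x0.  Then the solution truncated at K never reaches the truncation. *)
Lemma decaying_solution_exists (sigma d a Q0 : R) :
  0 < sigma -> 2 <= d -> 0 <= d / 2 - 1 / sigma -> 0 < a ->
  exists u v p q p' q',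
    smooth_radial_solution (power_nonlinearity sigma) sigma d a Q0 u v p q p' q' /\
    (forall eps, 0 < eps -> exists M, forall x, M < x -> u x * u x + v x * v x < eps).
Proof.
  intros Hs Hd Hsc Ha.
  destruct (lyapunov_constants sigma d a Hs Hd Ha)
    as [k [x0 [Hk [Heta [H1 [H2 [H3 [H4 H5]]]]]]]].
  set (e0 := Q0 * Q0 / 2 + Q0 * Q0 * rpow (Q0 * Q0) sigma / 2).
  set (G := e0 * exp ((2 + a / sigma) * x0)).
  set (B := 16 / (a * a) * ((2 + d + (d + 1) * (a * a * (x0 * x0))) * G)).
  assert (He0 : 0 <= e0).
  { unfold e0; generalize (Rle_0_sqr Q0) (rpow_nonneg (Q0 * Q0) sigma); unfold Rsqr; nra. }
  assert (HG : 0 <= G) by (apply Rmult_le_pos; [exact He0|left; apply exp_pos]).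
  assert (HB : 0 <= B).
  { unfold B; apply Rmult_le_pos; [left; apply Rdiv_lt_0_compat; nra|].
    apply Rmult_le_pos; [|exact HG]. assert (0 <= (d + 1) * (a * a * (x0 * x0))) by
      (apply Rmult_le_pos; lra). lra. }
  set (K := 2 * G + B).
  set (h := truncated_power sigma K).
  assert (Hhc : forall x, continuous h x) by (intros; apply truncated_power_continuous, Hs).
  destruct (smooth_radial_solution_exists h sigma d a Q0 ((1 + 2 * sigma) * rpow K sigma))
    as [u [v [p [q [p' [q' S]]]]]]; auto.
  { apply Rmult_le_pos; [lra|apply rpow_nonneg]. }
  { intros; apply truncated_power_lipschitz, Hs. }
  assert (W := smooth_radial_solution_weaken _ _ _ _ _ _ _ _ _ _ _ S).
  assert (HHd : forall s, is_derive (fun s => RInt h 0 s) s (h s))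
    by (intros; apply is_derive_primitive, Hhc).
  assert (HH0 : forall s, 0 <= s -> 0 <= RInt h 0 s)
    by (intros; apply truncated_primitive_nonneg; assumption).
  assert (Hh0 : forall s, 0 <= h s) by (intros; apply rpow_nonneg).
  assert (HE0 : (p 0 * p 0 + q 0 * q 0 + (u 0 * u 0 + v 0 * v 0)) / 2
            + RInt h 0 (u 0 * u 0 + v 0 * v 0) / 2 <= e0).
  { rewrite (energy_0 h (fun s => RInt h 0 s) sigma d a Q0 u v p q W).
    unfold e0; generalize (truncated_primitive_le sigma K (Q0 * Q0) Hs (Rle_0_sqr Q0)).
    fold h; lra. }
  assert (Hdecay : forall x, x0 <= x -> u x * u x + v x * v x <= B * exp (- (2 - k) * ln x)).
  { intros x Hx; unfold B, G.
    apply (modulus_decay h (fun s => RInt h 0 s) sigma d a Q0 u v p q); auto; lra. }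
  assert (HK : forall x, 0 <= x -> u x * u x + v x * v x <= K).
  { intros x Hx; unfold K; destruct (Rle_dec x x0) as [Hxx|Hxx].
    - assert (H := modulus_growth h (fun s => RInt h 0 s) sigma d a Q0 u v p q
        Hs Hd Ha HHd HH0 W x0 e0 x HE0 (conj Hx Hxx)).
      cbv beta in H; fold G in H; lra.
    - specialize (Hdecay x ltac:(lra)).
      assert (exp (- (2 - k) * ln x) <= 1).
      { rewrite <- exp_0.
        assert (0 < ln x) by (rewrite <- ln_1; apply ln_increasing; lra).
        left; apply exp_increasing; nra. }
      nra. }
  exists u, v, p, q, p', q'; split.
  - assert (Hpow : forall x, 0 <= x -> h (u x * u x + v x * v x)
                        = power_nonlinearity sigma (u x * u x + v x * v x)).
    { intros x Hx; apply truncated_power_eq, HK, Hx. }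
    split; try apply S.
    + intros x Hx; rewrite (srs_re S x Hx); unfold force_re.
      rewrite Hpow by lra; reflexivity.
    + intros x Hx; rewrite (srs_im S x Hx); unfold force_im.
      rewrite Hpow by lra; reflexivity.
  - intros eps He.
    destruct (power_decay_to_0 B (2 - k) eps ltac:(lra) He) as [M HM].
    exists (Rmax x0 M); intros x Hx.
    eapply Rle_lt_trans; [apply Hdecay|apply HM].
    + left; eapply Rle_lt_trans; [apply Rmax_l|exact Hx].
    + eapply Rle_lt_trans; [apply Rmax_r|exact Hx].
Qed.

(** * Uniqueness of the initial value problem *)

(** The Lipschitz bound is asked for only along the two solutions, so that it can
    be provided by a truncation above both of them. *)
Lemma radial_solution_unique (h : R -> R) (sigma d a Q0 K X : R)
    (u v p q u' v' p' q' : R -> R) :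
  0 < sigma -> 2 <= d -> 0 < a -> 0 <= K -> 0 <= X ->
  radial_solution h sigma d a Q0 u v p q ->
  radial_solution h sigma d a Q0 u' v' p' q' ->
  (forall x, 0 < x < X ->
     Rabs (h (u x * u x + v x * v x) * u x - h (u' x * u' x + v' x * v' x) * u' x)
       <= K * (Rabs (u x - u' x) + Rabs (v x - v' x)) /\
     Rabs (h (u x * u x + v x * v x) * v x - h (u' x * u' x + v' x * v' x) * v' x)
       <= K * (Rabs (u x - u' x) + Rabs (v x - v' x))) ->
  u X = u' X /\ v X = v' X.
Proof.
  intros Hs Hd Ha HK HX S S' Hlip.
  set (e := fun x => (u x - u' x) * (u x - u' x) + (v x - v' x) * (v x - v' x)
     + (p x - p' x) * (p x - p' x) + (q x - q' x) * (q x - q' x)).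
  assert (He : e X <= e 0 * exp ((2 + a / sigma + 4 * K) * X)).
  { eapply (gronwall e (fun x => 4 * ((u x - u' x) * (p x - p' x) + (v x - v' x) * (q x - q' x))
        + 2 * (a / sigma) * ((p x - p' x) * (v x - v' x) - (q x - q' x) * (u x - u' x))
        - 2 * (p x - p' x) * (h (u x * u x + v x * v x) * u x
             - h (u' x * u' x + v' x * v' x) * u' x)
        - 2 * (q x - q' x) * (h (u x * u x + v x * v x) * v x
             - h (u' x * u' x + v' x * v' x) * v' x)
        - 2 * ((d - 1) / x) * ((p x - p' x) * (p x - p' x) + (q x - q' x) * (q x - q' x))));
      [exact HX| | |].
    - intros x Hx; unfold e.
      generalize (rs_u_cont S x Hx) (rs_v_cont S x Hx) (rs_p_cont S x Hx) (rs_q_cont S x Hx)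
        (rs_u_cont S' x Hx) (rs_v_cont S' x Hx) (rs_p_cont S' x Hx) (rs_q_cont S' x Hx).
      intros; prove_continuous.
    - intros x [Hx _]; unfold e.
      assert (D1 := rs_u S x Hx); assert (D2 := rs_v S x Hx).
      assert (D3 := rs_p S x Hx); assert (D4 := rs_q S x Hx).
      assert (D5 := rs_u S' x Hx); assert (D6 := rs_v S' x Hx).
      assert (D7 := rs_p S' x Hx); assert (D8 := rs_q S' x Hx).
      auto_derive.
      + repeat split; first [exact I | eexists; eassumption].
      + fold_derivatives; unfold force_re, force_im; field; lra.
    - intros x Hx; cbv beta; unfold e.
      destruct (Hlip x Hx) as [L1 L2].
      set (g1 := _ - _) in L1; set (g2 := h _ * v x - _) in L2.
      fold g1 g2.
      set (U := u x - u' x) in *; set (V := v x - v' x) in *.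
      set (P := p x - p' x) in *; set (Q := q x - q' x) in *.
      assert (Has : 0 < a / sigma) by (apply Rdiv_lt_0_compat; assumption).
      assert (Hdx : 0 <= (d - 1) / x)
        by (apply Rmult_le_pos; [lra|left; apply Rinv_0_lt_compat; lra]).
      assert (Hfr : 0 <= (d - 1) / x * (P * P + Q * Q)).
      { apply Rmult_le_pos; [exact Hdx|apply Rplus_le_le_0_compat; apply Rle_0_sqr]. }
      assert (H1 : 4 * (U * P + V * Q) <= 2 * (U * U + V * V + P * P + Q * Q)).
      { generalize (Rle_0_sqr (U - P)) (Rle_0_sqr (V - Q)); unfold Rsqr; lra. }
      assert (H2 : 2 * (a / sigma) * (P * V - Q * U) <= a / sigma * (U * U + V * V + P * P + Q * Q)).
      { replace (2 * (a / sigma) * (P * V - Q * U))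
          with (a / sigma * (2 * (P * V - Q * U))) by ring.
        apply Rmult_le_compat_l; [lra|].
        generalize (Rle_0_sqr (P - V)) (Rle_0_sqr (Q + U)); unfold Rsqr; lra. }
      assert (Hg : forall r g, Rabs g <= K * (Rabs U + Rabs V) ->
                - 2 * r * g <= K * (2 * (r * r) + U * U + V * V)).
      { intros r g Hrg.
        apply Rle_trans with (2 * Rabs r * Rabs g).
        - replace (-2 * r * g) with (2 * (- (r * g))) by ring.
          rewrite Rmult_assoc, <- Rabs_mult.
          apply Rmult_le_compat_l; [lra|].
          rewrite <- Rabs_Ropp; apply Rle_abs.
        - apply Rle_trans with (2 * Rabs r * (K * (Rabs U + Rabs V))).
          + apply Rmult_le_compat_l; [generalize (Rabs_pos r); lra|exact Hrg].
          + replace (2 * Rabs r * (K * (Rabs U + Rabs V)))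
              with (K * (2 * Rabs r * (Rabs U + Rabs V))) by ring.
            apply Rmult_le_compat_l; [exact HK|].
            generalize (Rle_0_sqr (Rabs r - Rabs U)) (Rle_0_sqr (Rabs r - Rabs V)).
            generalize (Rsqr_abs r) (Rsqr_abs U) (Rsqr_abs V); unfold Rsqr; lra. }
      assert (G1 := Hg P g1 L1); assert (G2 := Hg Q g2 L2).
      assert (0 <= K * (U * U + V * V)).
      { apply Rmult_le_pos; [exact HK|apply Rplus_le_le_0_compat; apply Rle_0_sqr]. }
      assert (0 <= K * (P * P + Q * Q)).
      { apply Rmult_le_pos; [exact HK|apply Rplus_le_le_0_compat; apply Rle_0_sqr]. }
      lra. }
  replace (e 0) with 0 in He.
  2: { unfold e; rewrite (rs_u0 S), (rs_v0 S), (rs_p0 S), (rs_q0 S),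
         (rs_u0 S'), (rs_v0 S'), (rs_p0 S'), (rs_q0 S'); ring. }
  rewrite Rmult_0_l in He; unfold e in He.
  generalize (Rle_0_sqr (u X - u' X)) (Rle_0_sqr (v X - v' X))
    (Rle_0_sqr (p X - p' X)) (Rle_0_sqr (q X - q' X)); unfold Rsqr; intros.
  split; apply Rminus_diag_uniq, Rsqr_0_uniq; unfold Rsqr; lra.
Qed.

Lemma radial_solution_bounded h sigma d a Q0 u v p q X :
  radial_solution h sigma d a Q0 u v p q -> 0 <= X ->
  exists K, forall x, 0 <= x <= X -> u x * u x + v x * v x <= K.
Proof.
  intros S HX.
  destruct (continuity_ab_maj (fun x => u x * u x + v x * v x) 0 X HX) as [m [Hm _]].
  - intros c Hc; apply continuity_pt_filterlim.
    generalize (rs_u_cont S c (proj1 Hc)) (rs_v_cont S c (proj1 Hc)); intros.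
    change (continuous (fun x => u x * u x + v x * v x) c); prove_continuous.
  - exists (u m * u m + v m * v m); exact Hm.
Qed.

Lemma power_radial_solution_unique sigma d a Q0 u v p q u' v' p' q' X :
  0 < sigma -> 2 <= d -> 0 < a -> 0 <= X ->
  radial_solution (power_nonlinearity sigma) sigma d a Q0 u v p q ->
  radial_solution (power_nonlinearity sigma) sigma d a Q0 u' v' p' q' ->
  u X = u' X /\ v X = v' X.
Proof.
  intros Hs Hd Ha HX S S'.
  destruct (radial_solution_bounded _ _ _ _ _ _ _ _ _ X S HX) as [K1 HK1].
  destruct (radial_solution_bounded _ _ _ _ _ _ _ _ _ X S' HX) as [K2 HK2].
  set (K := Rmax K1 K2).
  apply (radial_solution_unique (power_nonlinearity sigma) sigma d a Q0
    ((1 + 2 * sigma) * rpow K sigma) X u v p q u' v' p' q'); auto.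
  { apply Rmult_le_pos; [lra|apply rpow_nonneg]. }
  intros x Hx.
  assert (E1 : power_nonlinearity sigma (u x * u x + v x * v x)
          = truncated_power sigma K (u x * u x + v x * v x)).
  { symmetry; apply truncated_power_eq; eapply Rle_trans; [apply HK1; lra|apply Rmax_l]. }
  assert (E2 : power_nonlinearity sigma (u' x * u' x + v' x * v' x)
          = truncated_power sigma K (u' x * u' x + v' x * v' x)).
  { symmetry; apply truncated_power_eq; eapply Rle_trans; [apply HK2; lra|apply Rmax_r]. }
  rewrite E1, E2; split.
  - apply truncated_power_lipschitz, Hs.
  - rewrite (Rplus_comm (u x * u x)), (Rplus_comm (u' x * u' x)), (Rplus_comm (Rabs (u x - u' x))).
    apply truncated_power_lipschitz, Hs.
Qed.

(** * Complex profiles and real solutions *)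

Lemma norm_C_R (z : C) : @norm _ C_R_NormedModule z = Cmod z.
Proof.
  unfold norm; simpl; unfold prod_norm, norm; simpl; unfold abs; simpl.
  unfold Cmod; f_equal; simpl.
  rewrite !Rmult_1_r, <- !Rabs_mult, !Rabs_pos_eq by apply Rle_0_sqr; reflexivity.
Qed.

(** The differential along a filter quantifies over all its limit points; along
    the half line at x >= 0 there is only x. *)
Lemma within_half_line_lim_unique (x y : R) :
  0 <= x -> is_filter_lim (within half_line (locally x)) y -> y = x.
Proof.
  intros Hx Hlim; destruct (Req_dec y x) as [E|E]; [exact E|exfalso].
  assert (He : 0 < Rabs (x - y)) by (apply Rabs_pos_lt; lra).
  destruct (Hlim (ball y (mkposreal _ He)) (locally_ball y (mkposreal _ He))) as [delta Hd].
  specialize (Hd x (ball_center x delta) Hx).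
  change (Rabs (x - y) < Rabs (x - y)) in Hd; lra.
Qed.

Lemma is_derive_on_half_line_epsilon (f f1 : R -> C) :
  is_derive_on half_line f f1 <->
  (forall x eps, 0 <= x -> 0 < eps -> exists delta, 0 < delta /\
     forall y, 0 <= y -> Rabs (y - x) < delta ->
       Rabs (fst (f y) - fst (f x) - (y - x) * fst (f1 x)) <= eps * Rabs (y - x) /\
       Rabs (snd (f y) - snd (f x) - (y - x) * snd (f1 x)) <= eps * Rabs (y - x)).
Proof.
  split.
  - intros H x eps Hx He.
    destruct (H x Hx) as [_ Hdom].
    specialize (Hdom x (filter_le_within half_line)).
    destruct (Hdom (mkposreal eps He)) as [delta Hdl].
    exists delta; split; [apply cond_pos|]; intros y Hy Hyx.
    specialize (Hdl y Hyx Hy); rewrite norm_C_R in Hdl.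
    eapply Rle_trans in Hdl; [|apply Rmax_Cmod].
    split; (eapply Rle_trans; [|exact Hdl]).
    + exact (Rmax_l _ _).
    + exact (Rmax_r _ _).
  - intros H x Hx; split; [apply is_linear_scal_l|].
    intros x' Hx'; rewrite (within_half_line_lim_unique x x' Hx Hx'); clear x' Hx'.
    intros eps.
    destruct (H x (eps / 2) Hx) as [delta [Hd Hf]]; [generalize (cond_pos eps); lra|].
    exists (mkposreal delta Hd); intros y Hyx Hy.
    destruct (Hf y Hy Hyx) as [H1 H2].
    rewrite norm_C_R.
    eapply Rle_trans; [apply Cmod_le_sum|].
    change (norm (minus y x)) with (Rabs (y - x)).
    replace (eps * Rabs (y - x)) with (eps / 2 * Rabs (y - x) + eps / 2 * Rabs (y - x)) by field.
    apply Rplus_le_compat; assumption.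
Qed.

Lemma is_derive_linear_approx (g : R -> R) (x l eps : R) :
  is_derive g x l -> 0 < eps -> exists delta, 0 < delta /\
    forall y, Rabs (y - x) < delta -> Rabs (g y - g x - (y - x) * l) <= eps * Rabs (y - x).
Proof.
  intros H He; apply is_derive_Reals in H.
  destruct (H eps He) as [delta Hd]; exists delta; split; [apply cond_pos|].
  intros y Hy; destruct (Req_dec y x) as [->|E].
  - rewrite !Rminus_diag, Rmult_0_l, Rminus_0_r, Rabs_R0; lra.
  - specialize (Hd (y - x) ltac:(lra) Hy).
    replace (x + (y - x)) with y in Hd by ring.
    replace (g y - g x - (y - x) * l) with (((g y - g x) / (y - x) - l) * (y - x))
      by (field; lra).
    rewrite Rabs_mult; apply Rmult_le_compat_r; [apply Rabs_pos|lra].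
Qed.

Lemma is_derive_on_pair (u v p q : R -> R) :
  (forall x, 0 <= x -> is_derive u x (p x)) -> (forall x, 0 <= x -> is_derive v x (q x)) ->
  is_derive_on half_line (fun x => (u x, v x)) (fun x => (p x, q x)).
Proof.
  intros Hu Hv; apply is_derive_on_half_line_epsilon; intros x eps Hx He; simpl.
  destruct (is_derive_linear_approx u x _ eps (Hu x Hx) He) as [d1 [Hd1 H1]].
  destruct (is_derive_linear_approx v x _ eps (Hv x Hx) He) as [d2 [Hd2 H2]].
  exists (Rmin d1 d2); split; [apply Rmin_pos; assumption|]; intros y _ Hy; split.
  - apply H1; eapply Rlt_le_trans; [exact Hy|apply Rmin_l].
  - apply H2; eapply Rlt_le_trans; [exact Hy|apply Rmin_r].
Qed.

(** A one-sided expansion at x gives a two-sided continuity of the extension that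
    is constant to the left of 0, since y |-> max(0, y) is 1-Lipschitz. *)
Lemma one_sided_continuous (g : R -> R) (x l : R) :
  0 <= x ->
  (exists delta, 0 < delta /\ forall y, 0 <= y -> Rabs (y - x) < delta ->
     Rabs (g y - g x - (y - x) * l) <= 1 * Rabs (y - x)) ->
  continuous (fun y => g (Rmax 0 y)) x.
Proof.
  intros Hx [delta [Hd Hg]]; apply continuous_epsilon; intros eps He.
  assert (Hl : 0 < Rabs l + 1) by (generalize (Rabs_pos l); lra).
  exists (Rmin delta (eps / (Rabs l + 1))); split.
  { apply Rmin_pos; [exact Hd|apply Rdiv_lt_0_compat; assumption]. }
  intros y Hy; rewrite (Rmax_right 0 x) by exact Hx.
  set (z := Rmax 0 y).
  assert (Hz : Rabs (z - x) <= Rabs (y - x)).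
  { unfold z, Rmax; destruct (Rle_dec 0 y); [lra|].
    unfold Rabs; repeat destruct Rcase_abs; lra. }
  assert (Hyd : Rabs (y - x) < delta) by (eapply Rlt_le_trans; [exact Hy|apply Rmin_l]).
  assert (Hye : Rabs (y - x) < eps / (Rabs l + 1))
    by (eapply Rlt_le_trans; [exact Hy|apply Rmin_r]).
  specialize (Hg z (Rmax_l 0 y) ltac:(lra)).
  replace (g z - g x) with ((g z - g x - (z - x) * l) + (z - x) * l) by ring.
  eapply Rle_lt_trans; [apply Rabs_triang|]; rewrite Rabs_mult.
  apply (Rmult_lt_compat_r (Rabs l + 1)) in Hye; [|exact Hl].
  unfold Rdiv in Hye; rewrite Rmult_assoc, Rinv_l, Rmult_1_r in Hye by lra.
  assert (Rabs (z - x) * (Rabs l + 1) <= Rabs (y - x) * (Rabs l + 1))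
    by (apply Rmult_le_compat_r; lra).
  lra.
Qed.

Lemma one_sided_is_derive (g : R -> R) (x l : R) :
  0 < x ->
  (forall eps, 0 < eps -> exists delta, 0 < delta /\ forall y, 0 <= y -> Rabs (y - x) < delta ->
     Rabs (g y - g x - (y - x) * l) <= eps * Rabs (y - x)) ->
  is_derive (fun y => g (Rmax 0 y)) x l.
Proof.
  intros Hx Hg.
  apply (is_derive_near g _ x l x Hx).
  { intros y Hy; apply Rabs_def2 in Hy; rewrite Rmax_right by lra; reflexivity. }
  apply is_derive_Reals; intros eps He.
  destruct (Hg (eps / 2)) as [delta [Hd Hdl]]; [lra|].
  assert (Hm : 0 < Rmin delta x) by (apply Rmin_pos; assumption).
  exists (mkposreal _ Hm); intros k Hk0 Hk; simpl in Hk.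
  assert (Hk1 : Rabs k < delta) by (eapply Rlt_le_trans; [exact Hk|apply Rmin_l]).
  assert (Hk2 : Rabs k < x) by (eapply Rlt_le_trans; [exact Hk|apply Rmin_r]).
  apply Rabs_def2 in Hk2.
  specialize (Hdl (x + k) ltac:(lra)); replace (x + k - x) with k in Hdl by ring.
  specialize (Hdl Hk1).
  assert (0 < Rabs k) by (apply Rabs_pos_lt; exact Hk0).
  replace ((g (x + k) - g x) / k - l) with ((g (x + k) - g x - k * l) / k) by (field; exact Hk0).
  unfold Rdiv at 1; rewrite Rabs_mult, Rabs_inv.
  apply Rmult_lt_reg_r with (Rabs k); [assumption|].
  rewrite Rmult_assoc, Rinv_l, Rmult_1_r by lra.
  assert (0 < eps * Rabs k) by (apply Rmult_lt_0_compat; assumption).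
  apply Rle_lt_trans with (1 := Hdl); lra.
Qed.

Lemma profile_lhs_components (sigma d a x : R) (Q Q1 Q2 : R -> C) :
  0 < sigma ->
  profile_lhs sigma d a Q Q1 Q2 x =
  (fst (Q2 x) + (d - 1) / x * fst (Q1 x)
     - force_re (power_nonlinearity sigma) sigma a x (fst (Q x)) (snd (Q x)) (snd (Q1 x)),
   snd (Q2 x) + (d - 1) / x * snd (Q1 x)
     - force_im (power_nonlinearity sigma) sigma a x (fst (Q x)) (snd (Q x)) (fst (Q1 x))).
Proof.
  intros Hs; unfold profile_lhs, radial_laplacian, force_re, force_im, power_nonlinearity.
  destruct (Q x) as [u v], (Q1 x) as [p q], (Q2 x) as [p' q'].
  rewrite <- Cmod_sqr, rpow_sqr by apply Cmod_ge_0.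
  set (g := rpow _ _); set (c := (d - 1) / x); clearbody g c.
  apply injective_projections; simpl; field; repeat split; nra.
Qed.

Lemma profile_radial_solution (sigma d a Q0 : R) (Q : R -> C) :
  0 < sigma -> is_profile sigma d a Q0 Q ->
  exists u v p q, radial_solution (power_nonlinearity sigma) sigma d a Q0 u v p q /\
    forall x, 0 <= x -> Q x = (u x, v x).
Proof.
  intros Hs [Q1 [Q2 [[HQ [HQ1 _]] [Heq [H10 [H00 _]]]]]].
  rewrite is_derive_on_half_line_epsilon in HQ, HQ1.
  exists (fun x => fst (Q (Rmax 0 x))), (fun x => snd (Q (Rmax 0 x))),
    (fun x => fst (Q1 (Rmax 0 x))), (fun x => snd (Q1 (Rmax 0 x))).
  assert (Hc : forall f f1 : R -> C, (forall x eps, 0 <= x -> 0 < eps -> exists delta, 0 < delta /\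
     forall y, 0 <= y -> Rabs (y - x) < delta ->
       Rabs (fst (f y) - fst (f x) - (y - x) * fst (f1 x)) <= eps * Rabs (y - x) /\
       Rabs (snd (f y) - snd (f x) - (y - x) * snd (f1 x)) <= eps * Rabs (y - x)) ->
     (forall x, 0 <= x -> continuous (fun x => fst (f (Rmax 0 x))) x /\
        continuous (fun x => snd (f (Rmax 0 x))) x) /\
     (forall x, 0 < x -> is_derive (fun x => fst (f (Rmax 0 x))) x (fst (f1 x)) /\
        is_derive (fun x => snd (f (Rmax 0 x))) x (snd (f1 x)))).
  { intros f f1 H; split.
    - intros x Hx; destruct (H x 1 Hx Rlt_0_1) as [delta [Hd Hf]]; split.
      + apply (one_sided_continuous (fun y => fst (f y)) x (fst (f1 x)) Hx).
        exists delta; split; [exact Hd|]; intros y Hy Hyx; apply (Hf y Hy Hyx).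
      + apply (one_sided_continuous (fun y => snd (f y)) x (snd (f1 x)) Hx).
        exists delta; split; [exact Hd|]; intros y Hy Hyx; apply (Hf y Hy Hyx).
    - intros x Hx; split.
      + apply (one_sided_is_derive (fun y => fst (f y)) x (fst (f1 x)) Hx); intros eps He.
        destruct (H x eps (Rlt_le _ _ Hx) He) as [delta [Hd Hf]].
        exists delta; split; [exact Hd|]; intros y Hy Hyx; apply (Hf y Hy Hyx).
      + apply (one_sided_is_derive (fun y => snd (f y)) x (snd (f1 x)) Hx); intros eps He.
        destruct (H x eps (Rlt_le _ _ Hx) He) as [delta [Hd Hf]].
        exists delta; split; [exact Hd|]; intros y Hy Hyx; apply (Hf y Hy Hyx). }
  destruct (Hc Q Q1 HQ) as [C0 D0]; destruct (Hc Q1 Q2 HQ1) as [C1 D1].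
  assert (Hpos : forall x, 0 < x -> Rmax 0 x = x) by (intros; apply Rmax_right; lra).
  assert (H0 : Rmax 0 0 = 0) by (apply Rmax_right; lra).
  assert (Hode : forall x, 0 < x ->
    fst (Q2 x) = force_re (power_nonlinearity sigma) sigma a x (fst (Q x)) (snd (Q x)) (snd (Q1 x))
       - (d - 1) / x * fst (Q1 x) /\
    snd (Q2 x) = force_im (power_nonlinearity sigma) sigma a x (fst (Q x)) (snd (Q x)) (fst (Q1 x))
       - (d - 1) / x * snd (Q1 x)).
  { intros x Hx; specialize (Heq x Hx); rewrite profile_lhs_components in Heq by exact Hs.
    injection Heq as E1 E2; split; lra. }
  split.
  - split.
    + intros x Hx; apply (C0 x Hx).
    + intros x Hx; apply (C0 x Hx).
    + intros x Hx; apply (C1 x Hx).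
    + intros x Hx; apply (C1 x Hx).
    + intros x Hx; rewrite Hpos by exact Hx; apply D0, Hx.
    + intros x Hx; rewrite Hpos by exact Hx; apply D0, Hx.
    + intros x Hx; rewrite Hpos by exact Hx.
      rewrite <- (proj1 (Hode x Hx)); apply D1, Hx.
    + intros x Hx; rewrite Hpos by exact Hx.
      rewrite <- (proj2 (Hode x Hx)); apply D1, Hx.
    + rewrite H0, H00; reflexivity.
    + rewrite H0, H00; reflexivity.
    + rewrite H0, H10; reflexivity.
    + rewrite H0, H10; reflexivity.
  - intros x Hx; rewrite Rmax_right by exact Hx; apply surjective_pairing.
Qed.

Lemma smooth_solution_is_profile (sigma d a Q0 : R) (u v p q p' q' : R -> R) :
  0 < sigma ->
  smooth_radial_solution (power_nonlinearity sigma) sigma d a Q0 u v p q p' q' ->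
  (forall eps, 0 < eps -> exists M, forall x, M < x -> u x * u x + v x * v x < eps) ->
  is_profile sigma d a Q0 (fun x => (u x, v x)).
Proof.
  intros Hs S Hlim.
  exists (fun x => (p x, q x)), (fun x => (p' x, q' x)).
  split; [split; [|split]|split; [|split; [|split]]].
  - apply is_derive_on_pair; [exact (srs_u S)|exact (srs_v S)].
  - apply is_derive_on_pair; [exact (srs_p S)|exact (srs_q S)].
  - intros x Hx; apply filterlim_locally; intros eps.
    destruct (proj1 (continuous_epsilon _ _) (srs_p' S x Hx) eps (cond_pos eps)) as [d1 [Hd1 H1]].
    destruct (proj1 (continuous_epsilon _ _) (srs_q' S x Hx) eps (cond_pos eps)) as [d2 [Hd2 H2]].
    assert (Hm : 0 < Rmin d1 d2) by (apply Rmin_pos; assumption).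
    exists (mkposreal _ Hm); intros y Hy _; split.
    + apply H1; eapply Rlt_le_trans; [exact Hy|apply Rmin_l].
    + apply H2; eapply Rlt_le_trans; [exact Hy|apply Rmin_r].
  - intros x Hx; rewrite profile_lhs_components by exact Hs; simpl.
    rewrite (srs_re S x Hx), (srs_im S x Hx); unfold RtoC; f_equal; ring.
  - rewrite (srs_p0 S), (srs_q0 S); reflexivity.
  - rewrite (srs_u0 S), (srs_v0 S); reflexivity.
  - apply filterlim_locally; intros eps.
    destruct (Hlim (eps * eps)) as [M HM]; [apply Rmult_lt_0_compat; apply cond_pos|].
    exists M; intros x Hx; specialize (HM x Hx).
    assert (Hsq : forall r, r * r < eps * eps -> Rabs (r - 0) < eps).
    { intros r Hr; rewrite Rminus_0_r, <- (Rabs_pos_eq eps) by (left; apply cond_pos).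
      apply Rsqr_lt_abs_0, Hr. }
    generalize (Rle_0_sqr (u x)) (Rle_0_sqr (v x)); unfold Rsqr; intros.
    split; [apply (Hsq (u x))|apply (Hsq (v x))]; lra.
Qed.

(** * Existence and uniqueness of the profile *)

Theorem theorem2p1 :
  forall sigma d : R,
    0 < sigma -> 2 <= d -> 0 < s_crit d sigma ->
    forall Q0 a : R, 0 < a ->
      exists Q : R -> C,
        is_profile sigma d a Q0 Q /\
        forall P : R -> C, is_profile sigma d a Q0 P ->
          forall xi : R, 0 <= xi -> P xi = Q xi.
Proof.
  intros sigma d Hs Hd Hsc Q0 a Ha; unfold s_crit in Hsc.
  destruct (decaying_solution_exists sigma d a Q0 Hs Hd (Rlt_le _ _ Hsc) Ha)
    as [u [v [p [q [p' [q' [S Hlim]]]]]]].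
  exists (fun x => (u x, v x)); split.
  - exact (smooth_solution_is_profile _ _ _ _ _ _ _ _ _ _ Hs S Hlim).
  - intros P HP xi Hxi.
    destruct (profile_radial_solution _ _ _ _ _ Hs HP) as [u' [v' [r [s [S' HP']]]]].
    rewrite (HP' xi Hxi).
    destruct (power_radial_solution_unique _ _ _ _ _ _ _ _ _ _ _ _ xi Hs Hd Ha Hxi S'
                (smooth_radial_solution_weaken _ _ _ _ _ _ _ _ _ _ _ S)) as [-> ->].
    reflexivity.
Qed.
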